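(* Let $F_1,\ldots,F_s$ be pairwise nonisomorphic connected nontrivial vertex-transitive Cartesian-prime graphs that are distance-regular, with diameters $D_i$. Let $m_i\ge1$ and $G=F_1^{\square m_1}\square\cdots\square F_s^{\square m_s}$, choose roots $r_i\in V(F_i)$, and let $a$ be the vertex of $G$ whose coordinate is $r_i$ in every copy of $F_i$. Then $$P_a\subseteq Q_a^-\subseteq U_a^-,\qquad \dim Q_a^-+1=\prod_{i=1}^s\binom{D_i+m_i}{m_i}.$$ Consequently $$\delta_{\ominus}(G,a)=\delta_{\mathrm{met}}+\delta_{\mathrm{orb}},\qquad \delta_{\mathrm{met}}=\dim Q_a^--\dim P_a\ge0,\qquad \delta_{\mathrm{orb}}=\dim U_a^--\dim Q_a^-\ge0 .$$ Here the remaining dimensions are given exactly by $$\dim P_a=\sum_{\lambda\in\Lambda}\operatorname{rank}R_\lambda-1,\qquad \dim U_a^-=\prod_{i=1}^s\binom{t_i+m_i-1}{m_i}-1,$$ with $\Lambda$, $R_\lambda$ and $t_i$ as defined in the context.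
   Context: All graphs are finite and simple; all vector spaces and algebras are over $\mathbb R$; $\square$ is the Cartesian product and $F^{\square m}$ the $m$-fold Cartesian power. A graph is nontrivial if it has at least two vertices; a nontrivial graph is Cartesian-prime if it is not isomorphic to a Cartesian product of two nontrivial graphs. For a connected regular graph $G$ with at least two vertices and $a\in V(G)$: $B=A(G-a)$ is the adjacency matrix of the vertex-deleted graph, $E$ is the diagonal matrix indexed by $V(G)\setminus\{a\}$ whose diagonal is the indicator of the neighbourhood $N(a)$, $\mathbf 1$ is the all-ones vector on $V(G)\setminus\{a\}$, $\mathcal B_a=\langle I,B,E\rangle$ is the real unital algebra generated by $B,E$, and $P_a=\mathcal B_a\mathbf 1$. $\operatorname{Aut}(G)_a$ is the stabilizer of $a$, $U_a^-=(\mathbb R^{V(G)\setminus\{a\}})^{\operatorname{Aut}(G)_a}$ is the space of vectors constant on its orbits, and $\delta_{\ominus}(G,a)=\dim U_a^--\dim P_a$. $Q_a^-$ is the span of the indicator vectors, in $\mathbb R^{V(G)\setminus\{a\}}$, of the non-root cells of the following partition of $V(G)$: two vertices lie in the same cell iff, for every $i$, the multisets of their coordinate distances from $r_i$ in the $m_i$ copies of $F_i$ agree. $t_i$ is the number of orbits of $\operatorname{Aut}(F_i)_{r_i}$ on $V(F_i)$, including the root orbit. Definition of $\Lambda$ and $R_\lambda$: for $(F_i,r_i)$ of valency $d_i$, let $E_\theta$ be the orthogonal projection onto the $\theta$-eigenspace of $A(F_i)$, $\Theta_i=\{\theta:E_\theta e_{r_i}\ne0\}$, $\omega_i(\theta)=\|E_\theta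 e_{r_i}\|^2$, $\Phi_i(z)=\sum_{\theta\in\Theta_i}\omega_i(\theta)e^{z\theta}$ and $\eta_i(z)=\frac1{d_i}\Phi_i'(z)/\Phi_i(z)$ for real $z$. Partition the set of all $m_1+\cdots+m_s$ factor copies into classes $I_1,\ldots,I_t$ according to equality of the functions $\eta_i$ (boundary classes); let $T_g$ be the sumset, over all factor copies in the class $I_g$, of the corresponding sets $\Theta_i$ (each copy contributing one summand), and let $\Lambda=T_1+\cdots+T_t$. For $\lambda\in\Lambda$, $R_\lambda$ is the matrix with one row $(1,y_1,\ldots,y_t)$ for each $(y_1,\ldots,y_t)\in T_1\times\cdots\times T_t$ with $y_1+\cdots+y_t=\lambda$. *)

(* Defs.v *)
From HB Require Import structures.
From mathcomp Require Import all_boot all_order all_algebra all_fingroup.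
From mathcomp Require Import all_classical all_reals all_analysis.
From mathcomp Require Import finmap sesquilinear.
Import Order.TTheory GRing.Theory Num.Theory.
Import numFieldNormedType.Exports.

Set Implicit Arguments.
Unset Strict Implicit.
Unset Printing Implicit Defensive.

Local Open Scope ring_scope.

Record sgraph := SGraph {
  vertex :> finType;
  adj : rel vertex;
  adj_sym : symmetric adj;
  adj_irr : irreflexive adj }.

Arguments adj {s} : rename.

Definition nontrivial (G : sgraph) : Prop := (1 < #|G|)%N.

Definition graph_connected (G : sgraph) : Prop := forall x y : G, connect adj x y.

Definition graph_iso (G H : sgraph) : Prop :=
  exists2 f : G -> H, bijective f & forall x y, adj (f x) (f y) = adj x y.

Definition valency (G : sgraph) (x : G) : nat := #|[pred y | adj x y]|.

(* The least length of a walk from x to y, and #|G| if there is none. *)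
Definition gdist (G : sgraph) (x y : G) : nat :=
  find (fun n => [exists p : n.-tuple G, path adj x p && (last x p == y)])
       (iota 0 #|G|).

Definition diameter (G : sgraph) : nat := \max_(x : G) \max_(y : G) gdist x y.

(* Intersection numbers b_i, c_i in the sense of Brouwer-Cohen-Neumaier; b_0 gives
   regularity. *)
Definition distance_regular (G : sgraph) : Prop :=
  graph_connected G /\
  exists b c : nat -> nat, forall x y : G,
    #|[pred z | adj y z && (gdist x z == (gdist x y).+1)]| = b (gdist x y) /\
    #|[pred z | adj y z && ((gdist x z).+1 == gdist x y)]| = c (gdist x y).

Definition Aut_graph (G : sgraph) : {set {perm G}} :=
  [set g : {perm G} | [forall x, forall y, adj (g x) (g y) == adj x y]]%SET.

Lemma Aut_graph_group_set (G : sgraph) : group_set (Aut_graph G).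
Proof.
apply/group_setP; split=> [|g h].
  by rewrite inE; apply/forallP=> x; apply/forallP=> y; rewrite !perm1.
rewrite !inE => /forallP gA /forallP hA.
apply/forallP=> x; apply/forallP=> y; rewrite !permM.
by rewrite (eqP (forallP (hA _) _)) (eqP (forallP (gA _) _)).
Qed.
Canonical Aut_graph_group (G : sgraph) := group (@Aut_graph_group_set G).

Definition vertex_transitive (G : sgraph) : Prop :=
  [transitive Aut_graph G, on [set: G]%SET | 'P].

Definition Aut_stab (G : sgraph) (a : G) : {set {perm G}} :=
  ('C_(Aut_graph G)[a | 'P])%g.

Definition num_orbits (G : sgraph) (a : G) : nat :=
  #|(orbit 'P (Aut_stab a) @: [set: G])%SET|.

Section VertexDeletion.
Variables (G : sgraph) (a : G).

Definition vdel_adj : rel {x : G | x != a} := fun x y => adj (val x) (val y).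

Lemma vdel_adj_sym : symmetric vdel_adj.
Proof. by move=> x y; exact: adj_sym. Qed.

Lemma vdel_adj_irr : irreflexive vdel_adj.
Proof. by move=> x; exact: adj_irr. Qed.

Definition vdel : sgraph := SGraph vdel_adj_sym vdel_adj_irr.

End VertexDeletion.

Section Cartesian2.
Variables G H : sgraph.

Definition cart2_adj : rel (G * H) := fun x y =>
  (x.1 == y.1) && adj x.2 y.2 || adj x.1 y.1 && (x.2 == y.2).

Lemma cart2_adj_sym : symmetric cart2_adj.
Proof.
by move=> x y; rewrite /cart2_adj ![y.1 == _]eq_sym ![y.2 == _]eq_sym
  ![adj y.1 _]adj_sym ![adj y.2 _]adj_sym.
Qed.

Lemma cart2_adj_irr : irreflexive cart2_adj.
Proof. by move=> x; rewrite /cart2_adj !adj_irr andbF. Qed.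

Definition cart2 : sgraph := SGraph cart2_adj_sym cart2_adj_irr.

End Cartesian2.

Definition cartesian_prime (G : sgraph) : Prop :=
  nontrivial G /\
  forall H K : sgraph, nontrivial H -> nontrivial K -> ~ graph_iso G (cart2 H K).

Section CartesianFamily.
Variables (I : finType) (F : I -> sgraph).

Definition cart_adj : rel {dffun forall i : I, F i} := fun x y =>
  [exists i, adj (x i) (y i) && [forall j, (j != i) ==> (x j == y j)]].

Lemma cart_adj_sym : symmetric cart_adj.
Proof.
move=> x y; apply: eq_existsb => i; rewrite adj_sym.
by congr andb; apply: eq_forallb => j; rewrite [x j == _]eq_sym.
Qed.

Lemma cart_adj_irr : irreflexive cart_adj.
Proof. by move=> x; apply/negbTE/existsP=> -[i]; rewrite adj_irr. Qed.

Definition cart : sgraph := SGraph cart_adj_sym cart_adj_irr.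

End CartesianFamily.

Section Span.
Variables (R : fieldType) (V : vectType R).

Lemma spanning_seq_exists (S : set V) : exists2 X : seq V,
  forall v, v \in X -> S v & forall v, S v -> v \in <<X>>%VS.
Proof.
have [n] := ubnP (\dim {:V} - \dim <<[::] : seq V>>)%N.
have : forall v : V, v \in [::] -> S v by [].
elim: n [::] => // n IHn X SX le_n.
have [sub|nsub] := pselect (forall v, S v -> v \in <<X>>%VS); first by exists X.
have [v Sv vX] : exists2 v, S v & v \notin <<X>>%VS.
  apply: contrapT => nex; apply: nsub => v Sv.
  by apply: contrapT => /negP vX; apply: nex; exists v.
apply: (IHn (v :: X)) => [u|]; first by rewrite inE => /predU1P[->|/SX].
have sXvX : (<<X>> <= <<v :: X>>)%VS by rewrite span_cons addvSr.
have ltX : (\dim <<X>> < \dim <<v :: X>>)%N.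
  rewrite ltn_neqAle dimvS // andbT; apply: contra vX => /eqP eqd.
  have /eqP -> : <<X>>%VS == <<v :: X>>%VS by rewrite eqEdim sXvX eqd /=.
  by rewrite memv_span ?mem_head.
have leV : (\dim <<v :: X>> <= \dim {:V})%N by rewrite dimvS ?subvf.
by rewrite -ltnS; apply: leq_trans le_n; rewrite ltnS ltn_sub2l //;
   apply: leq_trans ltX leV.
Qed.

Definition span_set (S : set V) : {vspace V} :=
  span (s2val (cid2 (spanning_seq_exists S))).

Lemma sub_span_set (S : set V) v : S v -> v \in span_set S.
Proof. by rewrite /span_set; case: cid2 => X /= _; apply. Qed.

Lemma span_set_min (S : set V) (U : {vspace V}) :
  (forall v, S v -> v \in U) -> (span_set S <= U)%VS.
Proof.
rewrite /span_set; case: cid2 => X /= SX _ SU.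
by apply/span_subvP => v /SX /SU.
Qed.

Lemma mem_span_set (S : set V) v :
  S 0 -> (forall c x y, S x -> S y -> S (c *: x + y)) ->
  v \in span_set S <-> S v.
Proof.
move=> S0 SL; split; last exact: sub_span_set.
rewrite /span_set; case: cid2 => X /= SX _.
elim: X SX v => [|x X IHX] SX v; first by rewrite span_nil memv0 => /eqP ->.
rewrite span_cons => /memv_addP[_ /vlineP[c ->] [u uX ->]].
apply: SL; first exact/SX/mem_head.
by apply: IHX uX => w wX; apply: SX; rewrite inE wX orbT.
Qed.

End Span.

(* The unital algebra generated by a set of square matrices. *)
Inductive gen_alg (R : pzRingType) n (X : set 'M[R]_n) : 'M[R]_n -> Prop :=
| gen_alg_in M of X M : gen_alg X M
| gen_alg1 : gen_alg X 1%:M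
| gen_algD M N of gen_alg X M & gen_alg X N : gen_alg X (M + N)
| gen_algZ c M of gen_alg X M : gen_alg X (c *: M)
| gen_algM M N of gen_alg X M & gen_alg X N : gen_alg X (M *m N).

(* Rows and columns are indexed through enum_val : 'I_#|G| -> G. *)
Definition adjmx (R : pzSemiRingType) (G : sgraph) : 'M[R]_#|G| :=
  \matrix_(i, j) (adj (enum_val i) (enum_val j))%:R.

Section RootedGraph.
Variables (R : realType) (G : sgraph) (a : G).

(* R^(V(G) \ {a}) *)
Local Notation space := 'cV[R]_#|vdel a|.

Definition nbr_mx : 'M[R]_#|vdel a| :=
  diag_mx (\row_i (adj a (val (enum_val i)))%:R).

Definition local_alg : {vspace 'M[R]_#|vdel a|} :=
  span_set (gen_alg [set adjmx R (vdel a); nbr_mx]%classic).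

Definition P_space : {vspace space} :=
  (linfun (mulmxr (const_mx 1 : space)) @: local_alg)%VS.

Definition U_space : {vspace space} :=
  span_set (fun v : space => forall i j : 'I_#|vdel a|,
    val (enum_val j) \in orbit 'P (Aut_stab a) (val (enum_val i)) ->
    v i 0 = v j 0).

Lemma mem_local_alg M :
  M \in local_alg <-> gen_alg [set adjmx R (vdel a); nbr_mx]%classic M.
Proof.
apply: mem_span_set => [|c M1 M2 gM1 gM2].
  by rewrite -(scale0r 1%:M); exact/gen_algZ/gen_alg1.
by apply: gen_algD => //; exact: gen_algZ.
Qed.

Lemma mem_U_space v : v \in U_space <-> forall i j : 'I_#|vdel a|,
  val (enum_val j) \in orbit 'P (Aut_stab a) (val (enum_val i)) ->
  v i 0 = v j 0.
Proof.
apply: mem_span_set => [i j _|c x y Sx Sy i j ij]; first by rewrite !mxE.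
by rewrite !mxE (Sx i j) ?(Sy i j).
Qed.

Definition cell_vec (C : {set G}) : space :=
  \col_i (val (enum_val i) \in C)%:R.

Definition delta_ominus : int := (\dim U_space)%:Z - (\dim P_space)%:Z.

(* The orthogonal projection E_theta, acting on row vectors. *)
Definition eigenproj (theta : R) : 'M[R]_#|G| :=
  let W := eigenspace (adjmx R G) theta in proj_mx W (orthomx idfun 1%:M W).

Definition root_proj (theta : R) : 'rV[R]_#|G| :=
  delta_mx 0 (enum_rank a) *m eigenproj theta.

Definition Theta : set R := (fun theta => root_proj theta != 0).

Definition omega (theta : R) : R := \sum_i root_proj theta 0 i ^+ 2.

Definition Phi (z : R) : R :=
  (\sum_(theta \in Theta) omega theta * expR (z * theta))%R.

Definition eta (z : R) : R :=
  (valency a)%:R^-1 * (derive1 Phi z / Phi z).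

End RootedGraph.

Arguments P_space R {G} a.
Arguments U_space R {G} a.
Arguments cell_vec R {G} a C.
Arguments delta_ominus R {G} a.
Arguments Theta R {G} a.
Arguments eta R {G} a z.

Section Product.
Variables (R : realType) (s : nat) (F : 'I_s -> sgraph) (m : 'I_s -> nat).
Variable r : forall i, F i.

(* The factor copies; the copy [Tagged _ j] of [F i] is the j-th one. *)
Definition copy : finType := {i : 'I_s & 'I_(m i)}.

Definition prod_graph : sgraph := cart (fun k : copy => F (tag k)).

Definition prod_root : prod_graph :=
  [ffun k : copy => r (tag k)] : {dffun forall k : copy, F (tag k)}.

Definition coord_dists (x : prod_graph) (i : 'I_s) : seq nat :=
  [seq gdist (r i) ((x : {dffun forall k : copy, F (tag k)})
                      (Tagged (fun i => 'I_(m i)) j)) | j : 'I_(m i)].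

Definition same_cell : rel prod_graph := fun x y =>
  [forall i, perm_eq (coord_dists x i) (coord_dists y i)].

Definition cells : {set {set prod_graph}} :=
  equivalence_partition same_cell [set: prod_graph]%SET.

Definition Q_space : {vspace 'cV[R]_#|vdel prod_root|} :=
  <<[seq cell_vec R prod_root C | C : {set prod_graph} <- enum cells &
          prod_root \notin C]>>%VS.

Definition delta_met : int :=
  (\dim Q_space)%:Z - (\dim (P_space R prod_root))%:Z.

Definition delta_orb : int :=
  (\dim (U_space R prod_root))%:Z - (\dim Q_space)%:Z.

Definition boundary_classes : {set {set copy}} :=
  equivalence_partition
    (fun k l : copy => `[< eta R (r (tag k)) = eta R (r (tag l)) >])
    [set: copy]%SET.

Local Notation t := #|boundary_classes|.

Definition T_sum (g : 'I_t) : set R := (fun y =>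
  exists2 th : copy -> R, forall k, k \in enum_val g -> Theta R (r (tag k)) (th k)
                        & y = \sum_(k in enum_val g) th k)%R.

Definition T_prod : set 'rV[R]_t := (fun y => forall g, T_sum g (y 0 g)).

Definition Lambda : set R :=
  (fun lam => exists2 y, T_prod y & lam = \sum_g y 0 g).

Definition T_fiber (lam : R) : set 'rV[R]_t :=
  (fun y => T_prod y /\ \sum_g y 0 g = lam).

Definition R_mx (lam : R) : 'M[R]_(#|` fset_set (T_fiber lam)|%fset, 1 + t) :=
  \matrix_(k < #|` fset_set (T_fiber lam)|%fset)
     row_mx (const_mx 1) (nth 0 (fset_set (T_fiber lam)) k).

End Product.

Arguments prod_root {s F} m r.
Arguments same_cell {s F} m r.
Arguments cells {s F} m r.
Arguments Q_space R {s F} m r.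
Arguments delta_met R {s F} m r.
Arguments delta_orb R {s F} m r.
Arguments boundary_classes R {s F} m r.
Arguments Lambda R {s F} m r.
Arguments R_mx {R s F} m r lam.

(* Main.v *)
Require Import Defs.
From HB Require Import structures.
From mathcomp Require Import all_boot all_order all_algebra all_fingroup.
From mathcomp Require Import all_classical all_reals all_analysis.
From mathcomp Require Import finmap complex sesquilinear spectral mxred.
From mathcomp Require Import zify ring.
Import Order.TTheory GRing.Theory Num.Theory numFieldNormedType.Exports.
Set Implicit Arguments.
Unset Strict Implicit.
Unset Printing Implicit Defensive.
Local Open Scope ring_scope.

(** Why the statement holds.

    An automorphism of a Cartesian product of connected prime graphs that fixes the root [a]
    permutes the factors: layers through [a] are convex, convex sets are boxes, and a prime
    graph is not a nontrivial box ([layer_to_layer]); coordinates are recovered as nearest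
    points in layers ([stab_permutes_factors]). Hence an orbit of the stabiliser amounts to
    the choice, for each [i], of a multiset of [m i] orbits in [F i], while a cell amounts to a
    multiset of [m i] distances. Counting multisets ([card_multicolor]) gives the dimensions
    of Q and U; automorphisms of the factors preserve distances, so Q lies in U.

    For P, decompose the indicator of the root into joint eigenvectors of the adjacency
    operators of all copies: one vector [tensor_vec tau] for each choice [tau] of an eigenvalue
    per copy, with weight [joint_weight tau] at the root. Functions on the product become
    coefficient functions of [tau] ([expand]), the adjacency operator becomes multiplication
    by [eig_sum tau], and the indicator of the neighbours of [a] in the directions of a
    boundary class [g] becomes the coefficient [class_sum tau g]. Together with the line of the
    root, P is the space of the coefficients
    al (eig_sum tau) + sum over g of be g (eig_sum tau) * class_sum tau g ([mem_P_space]).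

    That P is contained in this space rests on [class_moment]: copies with the same
    boundary function have first moments proportional to their valencies once all class sums
    are given, so these functions take a single value on the neighbours attached to a class, and restriction to the
    neighbourhood of [a] stays within the space. For the converse, restricting to
    the neighbourhood, spreading by the adjacency operator and restricting again produces the
    second moments ([second_moment]); modulo the first moments this multiplies the class
    indicators by the derivatives of the boundary functions. Boundary functions vanish at 0, so
    distinct ones have distinct derivatives, and these multiplications isolate each class.

    Grouping the coefficients by the value of [eig_sum] splits the space into eigenspaces of
    the adjacency operator. In the one for [lam], the components with a given vector of class
    sums are linearly independent, and the spanning functions have the columns of the matrix
    of [lam] as coordinates; this is the rank formula. Finally P lies in Q because every
    coefficient depends on the class sums only, which permutations of isomorphic
    factors preserve, and because root eigenvectors of distance-regular graphs depend only on
    the distance to the root. *)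

(** * Distances in graphs and in Cartesian products *)

Section GraphMetric.
Variable G : sgraph.
Hypothesis G_conn : graph_connected G.
Implicit Types x y z : G.

(** The search defining [gdist] stops at #|G|, so longer walks satisfy the bound trivially. *)
Lemma gdist_path x p : path adj x p -> (gdist x (last x p) <= size p)%N.
Proof.
move=> px; rewrite leqNgt; apply/negP => lt_p.
have /(before_find 0%N) : (size p < gdist x (last x p))%N by [].
rewrite nth_iota; last first.
  by apply: leq_trans lt_p _; rewrite -[#|G| in leqRHS](size_iota 0) find_size.
by move/existsP; apply; exists (in_tuple p); rewrite /= px eqxx.
Qed.

(** Erasing the loops of a walk leaves fewer than #|G| steps, so the bounded search
    defining [gdist] succeeds in a connected graph. *)
Lemma gdistP x y :
  exists p, [/\ path adj x p, last x p = y & size p = gdist x y].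
Proof.
have /connectP[p px ->] := G_conn x y.
case: (shortenP px) => q qx uq _.
set a := fun n => [exists p : n.-tuple G, path adj x p && (last x p == last x q)].
have ltq : (size q < #|G|)%N by have := max_card (mem (x :: q)); rewrite (card_uniqP uq).
have ha : has a (iota 0 #|G|).
  apply/hasP; exists (size q); first by rewrite mem_iota.
  by apply/existsP; exists (in_tuple q); rewrite /= qx eqxx.
have := nth_find 0%N ha; rewrite nth_iota; last by rewrite -[X in (_ < X)%N](size_iota 0) -has_find.
case/existsP => t /andP[tp /eqP tl]; exists (val t).
by rewrite size_tuple.
Qed.

Lemma gdistxx x : gdist x x = 0%N.
Proof. by apply/eqP; rewrite -leqn0; apply: (@gdist_path x [::]). Qed.

Lemma gdist_eq0 x y : (gdist x y == 0%N) = (x == y).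
Proof.
apply/idP/eqP => [|->]; last by rewrite gdistxx.
by have [[|z p] [//= _ lp <-]] := gdistP x y.
Qed.

Lemma gdist_triangle y x z : (gdist x z <= gdist x y + gdist y z)%N.
Proof.
have [p [xp <- <-]] := gdistP x y; have [q [yq <- <-]] := gdistP (last x p) z.
by rewrite -last_cat -size_cat gdist_path // cat_path xp.
Qed.

Lemma gdistC x y : gdist x y = gdist y x.
Proof.
suff le x' y' : (gdist x' y' <= gdist y' x')%N by apply/eqP; rewrite eqn_leq !le.
have [p [yp lp <-]] := gdistP y' x'.
have := @gdist_path x' (rev (belast y' p)).
rewrite -{1}lp rev_path (eq_path (e' := adj)) // => [/(_ yp)|u v]; last exact: adj_sym.
have -> : last x' (rev (belast y' p)) = y'.
  by case: p {yp} lp => [|z p] //= lp; rewrite rev_cons last_rcons.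
by rewrite size_rev size_belast.
Qed.

Lemma gdist_adj x y : adj x y -> gdist x y = 1%N.
Proof.
move=> xy; apply/eqP; rewrite eqn_leq (@gdist_path x [:: y]) /= ?xy //.
rewrite lt0n gdist_eq0; apply/eqP => e; by rewrite e adj_irr in xy.
Qed.

Lemma gdist_step x y : x != y ->
  exists2 z, adj x z & gdist x y = (gdist z y).+1.
Proof.
move=> xy; have [[|z p] [/= + + sp]] := gdistP x y.
  by move=> _ e; rewrite e eqxx in xy.
case/andP => xz zp lp; exists z => //; apply/eqP; rewrite eqn_leq.
rewrite -[(gdist z y).+1]add1n -(gdist_adj xz) gdist_triangle /=.
by rewrite -sp (gdist_adj xz) add1n ltnS -lp gdist_path.
Qed.

(** Walking back from [y] towards [x] lowers the distance to [x] by one at each step. *)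
Lemma gdist_mid x y n : (n <= gdist x y)%N -> exists z, gdist x z = n.
Proof.
move: {2}(gdist x y - n)%N (erefl (gdist x y - n)%N) => k.
elim: k y => [|k IH] y e le_n.
  by exists y; apply/eqP; rewrite eqn_leq le_n andbT -subn_eq0 e.
have nyx : y != x by apply/eqP => yx; rewrite yx gdistxx in e.
have [z yz dz] := gdist_step nyx.
by apply: (IH z); move: e le_n; rewrite gdistC dz (gdistC z); lia.
Qed.

Lemma gdist_aut (g : {perm G}) x y :
  g \in Aut_graph G -> gdist (g x) (g y) = gdist x y.
Proof.
suff le h x' y' : h \in Aut_graph G -> (gdist (h x') (h y') <= gdist x' y')%N.
  move=> gA; apply/eqP; rewrite eqn_leq le //= -{1}[x](permK g) -{1}[y](permK g).
  by rewrite le // groupV.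
rewrite inE => /forallP hA; have [p [xp <- <-]] := gdistP x' y'.
rewrite -last_map -(size_map h) gdist_path //.
by rewrite path_map (eq_path (e' := adj)) // => u v; exact/eqP/(forallP (hA u)).
Qed.

End GraphMetric.

Lemma Aut_graphP (G : sgraph) (g : {perm G}) :
  reflect (forall x y, adj (g x) (g y) = adj x y) (g \in Aut_graph G).
Proof.
rewrite inE; apply: (iffP forallP) => [h x y|h x]; first exact/eqP/(forallP (h x)).
by apply/forallP => y; rewrite h.
Qed.

Lemma Aut_stabP (G : sgraph) (a : G) (g : {perm G}) :
  reflect (g \in Aut_graph G /\ g a = a) (g \in Aut_stab a).
Proof.
apply: (iffP setIP) => [] [gA].
  by move/astab1P=> /= ga; split.
by move=> ga; split => //; apply/astab1P.
Qed.

Section Cart.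
Variables (I : finType) (F : I -> sgraph).
Hypothesis F_conn : forall i, graph_connected (F i).
Local Notation T := {dffun forall i : I, F i}.
Local Notation adjT := (@adj (cart F)).
Implicit Types x y z : T.

Definition upd x (i : I) (u : F i) : T := [ffun j => eqtype.dfwith x u j].

Lemma upd_in x i (u : F i) : upd x u i = u.
Proof. by rewrite ffunE eqtype.dfwith_in. Qed.

Lemma upd_out x i (u : F i) j : j != i -> upd x u j = x j.
Proof. by move=> ij; rewrite ffunE eqtype.dfwith_out // eq_sym. Qed.

Lemma upd_id x i : upd x (x i) = x.
Proof.
by apply/ffunP => j; have [->|ji] := eqVneq j i; rewrite ?upd_in ?upd_out.
Qed.

Lemma upd_upd x i (u v : F i) : upd (upd x u) v = upd x v.
Proof.
by apply/ffunP => j; have [->|ji] := eqVneq j i; rewrite ?upd_in ?upd_out.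
Qed.

Lemma upd_inj x i : injective (@upd x i).
Proof. by move=> u v /ffunP/(_ i); rewrite !upd_in. Qed.

Lemma upd_eqP x y i : reflect (forall j, j != i -> x j = y j) (x == upd y (x i)).
Proof.
apply: (iffP eqP) => [-> j ji|h]; first by rewrite upd_out.
apply/ffunP => j; have [->|ji] := eqVneq j i; first by rewrite upd_in.
by rewrite upd_out // h.
Qed.

Lemma cartP x y :
  reflect (exists i, adj (x i) (y i) /\ y = upd x (y i)) (adjT x y).
Proof.
apply: (iffP existsP) => [] [i ].
  case/andP=> a /forallP h; exists i; split=> //; apply/eqP/upd_eqP => j ji.
  by apply/esym/eqP; have := h j; rewrite ji.
case=> a /eqP/upd_eqP h; exists i; rewrite a; apply/forallP => j.
by apply/implyP => ji; rewrite h.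
Qed.

Lemma adj_upd x i (u v : F i) : adjT (upd x u) (upd x v) = adj u v.
Proof.
apply/cartP/idP => [[j [+ e]]|uv]; last first.
  by exists i; rewrite upd_upd !upd_in.
have [->|ji] := eqVneq j i; first by rewrite !upd_in.
by rewrite !upd_out // adj_irr.
Qed.

Definition sumdist x y := (\sum_i gdist (x i) (y i))%N.

Lemma sumdist_upd x y i :
  sumdist x y = (gdist (x i) (y i) + \sum_(j | j != i) gdist (x j) (y j))%N.
Proof. by rewrite /sumdist (bigD1 i). Qed.

(** A walk of this length repairs the coordinates one unit of distance at a time. *)
Lemma sumdist_walk x y :
  exists p, [/\ path adjT x p, last x p = y & size p = sumdist x y].
Proof.
move: {2}(sumdist x y) (erefl (sumdist x y)) => n; elim: n x => [|n IH] x e.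
  exists [::]; split=> //=; apply/ffunP => i; apply/eqP.
  rewrite -(gdist_eq0 (@F_conn i)); move: e; rewrite (sumdist_upd _ _ i); lia.
have [i xyi|h] := pickP (fun i => x i != y i); last first.
  move: e; rewrite /sumdist big1 // => i _.
  by have /negbFE/eqP -> := h i; rewrite gdistxx.
have [z xz dz] := gdist_step (@F_conn i) xyi.
have [|p [pz pl ps]] := IH (upd x z).
  move: e; rewrite !(sumdist_upd _ _ i) upd_in dz addSn => -[<-].
  by congr addn; apply: eq_bigr => j ji; rewrite upd_out.
exists (upd x z :: p); split => //.
  by rewrite /= pz andbT; apply/cartP; exists i; rewrite upd_in.
rewrite /= ps !(sumdist_upd _ _ i) upd_in dz addSn.
by congr _.+1; congr addn; apply: eq_bigr => j ji; rewrite upd_out.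
Qed.

Lemma cart_connected : graph_connected (cart F).
Proof. by move=> x y; have [p [xp <- _]] := sumdist_walk x y; apply/connectP; exists p. Qed.

(** A walk in the product changes one coordinate at a time, hence shortens the
    coordinate distances by at most one in total at each step. *)
Lemma gdist_cart x y : @gdist (cart F) x y = sumdist x y.
Proof.
apply/eqP; rewrite eqn_leq; apply/andP; split.
  by have [p [xp <- <-]] := sumdist_walk x y; exact: gdist_path.
have [p [+ <- <-]] := gdistP cart_connected x y.
elim: p x => [|z p IH] x /=; first by rewrite /sumdist big1 // => i _; rewrite gdistxx.
case/andP => /cartP[i [xz ez]] /IH; set w := last _ _ => le.
apply: leq_trans (_ : (sumdist z w).+1 <= _)%N; last by [].
rewrite !(sumdist_upd _ _ i) -addSn; apply: leq_add.
  by rewrite -add1n -(gdist_adj (@F_conn i) xz); apply: gdist_triangle.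
by apply: eq_leq; apply: eq_bigr => j ji; rewrite ez upd_out.
Qed.

End Cart.

(** * Automorphisms of Cartesian products of prime graphs *)

Section Induced.
Variables (G : sgraph) (P : pred G).
Definition induced_adj : rel {x : G | P x} := fun x y => adj (val x) (val y).
Lemma induced_adj_sym : symmetric induced_adj.
Proof. by move=> x y; exact: adj_sym. Qed.
Lemma induced_adj_irr : irreflexive induced_adj.
Proof. by move=> x; exact: adj_irr. Qed.
Definition induced : sgraph := SGraph induced_adj_sym induced_adj_irr.
End Induced.

Lemma inj_surj_bij (A B : Type) (f : A -> B) :
  injective f -> (forall y, exists x, f x = y) -> bijective f.
Proof.
move=> fI fS; have [g fg] := choice fS; exists g => // x.
exact/fI/fg.
Qed.

Section Stabiliser.
Variables (I : finType) (F : I -> sgraph).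
Hypothesis F_conn : forall i, graph_connected (F i).
Hypothesis F_prime : forall i, cartesian_prime (F i).
Local Notation T := {dffun forall i : I, F i}.
Variable a : T.
Implicit Types x y z : T.

(** Setting one coordinate aside presents the indexed product as a product of two graphs,
    the form in which primality is stated; the remaining coordinates are recorded by
    resetting coordinate [i] to that of [a]. *)
Lemma adj_cart_split x y i : @adj (cart F) x y =
  ((x i == y i) && @adj (cart F) (upd x (a i)) (upd y (a i)))
  || (adj (x i) (y i) && (upd x (a i) == upd y (a i))).
Proof.
apply/cartP/idP => [[j [xy e]]|].
  have [ij|ij] := eqVneq i j.
    apply/orP; right; rewrite ij xy /=; apply/eqP.
    by rewrite -ij in e *; rewrite e upd_upd.
  apply/orP; left; rewrite {1}e upd_out // eqxx /=; apply/cartP; exists j.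
  split; [by rewrite !upd_out 1?eq_sym | apply/eqP/upd_eqP => l lj].
  have [->|li] := eqVneq l i; first by rewrite !upd_in.
  by rewrite e !upd_out.
case/orP => /andP[].
  move=> /eqP xyi /cartP[j [xy e]].
  have ji : j != i by apply/eqP => ji; subst j; rewrite !upd_in adj_irr in xy.
  rewrite !upd_out // in xy; exists j; split=> //; apply/eqP/upd_eqP => l lj.
  have [->//|li] := eqVneq l i.
  by have := congr1 (fun z : T => z l) e; rewrite /= !upd_out.
move=> xy /eqP e; exists i; split=> //; apply/eqP/upd_eqP => l li.
by have := congr1 (fun z : T => z l) e; rewrite /= !upd_out.
Qed.

Variable phi : {perm (cart F)}.
Hypothesis phi_aut : phi \in Aut_graph (cart F).
Hypothesis phi_a : phi a = a :> T.
Local Notation f x := (phi x : T) (only parsing).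

Lemma sumdist_aut x y : sumdist (f x) (f y) = sumdist x y.
Proof.
by rewrite -!gdist_cart // (gdist_aut (cart_connected F_conn) _ _ phi_aut).
Qed.

(** Layers are convex: two vertices of a layer agree with [a] outside coordinate [k], so the
    coordinates of a vertex on a geodesic between them have distance 0 to those of [a] there.
    Automorphisms preserve distances, hence carry this over to images of layers. *)
Lemma layer_convex k (u v : F k) z :
  (sumdist (f (upd a u)) z + sumdist z (f (upd a v)) =
     sumdist (f (upd a u)) (f (upd a v)))%N ->
  exists w : F k, z = f (upd a w).
Proof.
rewrite (_ : z = f ((phi^-1)%g z : T)); last by rewrite permKV.
move: ((phi^-1)%g z : T) => {}z; rewrite !sumdist_aut !(sumdist_upd _ _ k) !upd_in.
have s0 : (\sum_(j | j != k) gdist (upd a u j) (upd a v j) = 0)%N.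
  by apply: big1 => j jk; rewrite !upd_out // gdistxx.
rewrite s0 => e; exists (z k); congr (phi _ : T); apply/eqP/upd_eqP => j jk.
have le := gdist_triangle (@F_conn k) (z k) u v.
have /eqP : (\sum_(j | j != k) gdist (upd a u j) (z j) = 0)%N by lia.
rewrite sum_nat_eq0 => /forallP/(_ j); rewrite jk upd_out //= gdist_eq0 //.
by move/eqP.
Qed.

(** Convex subgraphs of a Cartesian product are boxes: replacing one coordinate of a member
    by that of another member gives a vertex on a geodesic between the two. If the image of a
    layer moved both in direction [k'] and in some other direction, it would present the prime
    graph [F k] as a product of two nontrivial graphs, the projections [P1] and [P2]. *)
Lemma layer_to_layer k : exists k', forall u : F k,
  f (upd a u) = upd a (f (upd a u) k').
Proof.
have /card_gt1P[u0 [u1 [_ _ u01]]] := (F_prime k).1.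
have [u ua] : exists u : F k, u != a k.
  have [e|] := eqVneq u0 (a k); last by exists u0.
  by exists u1; rewrite -e eq_sym.
have [k' fuk'|h] := pickP (fun l => f (upd a u) l != a l); last first.
  case/eqP: ua; apply: (@upd_inj _ _ a k); rewrite upd_id.
  apply: (@perm_inj _ phi); rewrite phi_a; apply/ffunP => l; exact/eqP/negbFE/h.
exists k' => w; apply: contrapT => nw.
pose P1 : pred (F k') := fun t => [exists v : F k, f (upd a v) k' == t].
pose P2 : pred (cart F) := fun t => [exists v : F k, upd (f (upd a v)) (a k') == t].
have p1 (v : F k) : P1 (f (upd a v) k') by apply/existsP; exists v.
have p2 (v : F k) : P2 (upd (f (upd a v)) (a k')) by apply/existsP; exists v.
pose g1 (v : F k) : induced P1 := exist P1 _ (p1 v).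
pose g2 (v : F k) : induced P2 := exist P2 _ (p2 v).
pose g v : cart2 (induced P1) (induced P2) := (g1 v, g2 v).
have phiI := @perm_inj _ phi.
apply: ((F_prime k).2 (induced P1) (induced P2)).
- apply/card_gt1P; exists (g1 u), (g1 (a k)); split=> //.
  by rewrite -val_eqE /= upd_id phi_a.
- apply/card_gt1P; exists (g2 w), (g2 (a k)); split=> //.
  rewrite -val_eqE /= upd_id phi_a upd_id; apply/eqP => e; apply: nw.
  by have := congr1 (fun z : T => upd z (f (upd a w) k')) e; rewrite upd_upd upd_id.
exists g; last first.
  by move=> v v'; rewrite -(adj_upd a) -(Aut_graphP _ phi_aut) (adj_cart_split _ _ k').
apply: inj_surj_bij => [v v' [e1 e2]|[t z]].
  apply: (@upd_inj _ _ a k); apply: phiI; rewrite -(upd_id (phi (upd a v) : T) k').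
  by rewrite -(upd_upd _ (a k')) e2 upd_upd e1 upd_id.
have /existsP[v /eqP vt] := valP t; have /existsP[v' /eqP vz] := valP z.
(* The box property: this vertex lies on a geodesic from phi (upd a v) to phi (upd a v'). *)
have [w' ew'] : exists w' : F k, upd (val z : T) (val t) = f (upd a w').
  apply: (@layer_convex k v v' (upd (val z : T) (val t))); rewrite !(sumdist_upd _ _ k') -vz -vt upd_upd upd_in.
  rewrite gdistxx add0n [X in (_ + (_ + X))%N]big1 => [|j jk]; last first.
    by rewrite upd_out // gdistxx.
  rewrite addn0 addnC; congr addn; apply: eq_bigr => j jk; by rewrite upd_out.
exists w'; congr (_, _); apply: val_inj; rewrite /= -ew' ?upd_in //.
by rewrite upd_upd -vz upd_upd.
Qed.

End Stabiliser.

Section PermutedFactors.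
Variables (I : finType) (F : I -> sgraph).
Hypothesis F_conn : forall i, graph_connected (F i).
Hypothesis F_prime : forall i, cartesian_prime (F i).
Local Notation T := {dffun forall i : I, F i}.
Variable a : T.

(** Applying [layer_to_layer] to [phi] and to its inverse shows that layers through [a] are
    mapped onto layers through [a]. The coordinate of [x] in direction [k] names the unique
    vertex of that layer nearest to [x], and automorphisms preserve nearest vertices. *)
Lemma stab_permutes_factors (phi : {perm (cart F)}) :
  phi \in Aut_stab (a : cart F) ->
  exists2 sigma : I -> I, injective sigma &
    forall k, exists psi : F k -> F (sigma k),
      [/\ bijective psi, forall u v, adj (psi u) (psi v) = adj u v &
          forall x : T, (phi x : T) (sigma k) = psi (x k)].
Proof.
case/Aut_stabP => phiA phia.
have phiVA : (phi^-1)%g \in Aut_graph (cart F) by rewrite groupV.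
have phiVa : (phi^-1)%g a = a by rewrite -{1}phia permK.
have [sigma Hs] := choice (layer_to_layer F_conn F_prime phiA phia).
have [tau Ht] := choice (layer_to_layer F_conn F_prime phiVA phiVa).
(* The layer of k, pulled back from its image, lies in the layer of tau (sigma k); since it is
   nontrivial, the two layers coincide. *)
have tau_sigma k : tau (sigma k) = k.
  have /card_gt1P[u0 [u1 [_ _ u01]]] := (F_prime k).1.
  have [u ua] : exists u : F k, u != a k.
    have [e|] := eqVneq u0 (a k); last by exists u0.
    by exists u1; rewrite -e eq_sym.
  apply/eqP; apply: contraNT ua => tk; apply/eqP.
  have := Ht _ ((phi (upd a u) : T) (sigma k)); rewrite -Hs permK.
  by move/(congr1 (fun z : T => z k)); rewrite upd_in upd_out // eq_sym.
exists sigma; first exact: can_inj tau_sigma.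
move=> k; exists (fun u => (phi (upd a u) : T) (sigma k)).
have phiI := @perm_inj _ phi.
have psiS t : exists u : F k, (phi (upd a u) : T) (sigma k) = t.
  have := Ht _ t; rewrite tau_sigma => e; exists (((phi^-1)%g (upd a t) : T) k).
  by rewrite -e permKV upd_in.
split.
- apply: inj_surj_bij => // u v /= e; apply: (@upd_inj _ _ a k); apply: phiI.
  by rewrite (Hs k u) (Hs k v) e.
- move=> u v; rewrite -(adj_upd a u v) -(Aut_graphP _ phiA) [in RHS](Hs k u).
  by rewrite [in RHS](Hs k v) adj_upd.
move=> x; apply/eqP; rewrite -gdist_eq0 //; apply/eqP.
have D u : (gdist (x k) u + \sum_(j | j != k) gdist (x j) (a j) =
   gdist ((phi x : T) (sigma k)) ((phi (upd a u) : T) (sigma k)) +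
   \sum_(j | j != sigma k) gdist ((phi x : T) j) (a j))%N.
  have := sumdist_aut F_conn phiA x (upd a u).
  rewrite [phi (upd a u) in LHS](Hs k u).
  rewrite (sumdist_upd _ _ (sigma k)) (sumdist_upd _ _ k) !upd_in => e.
  rewrite (eq_bigr (fun j => gdist (x j) (upd a u j))) => [|j jk]; last by rewrite upd_out.
  rewrite -e; congr addn; apply: eq_bigr => j jk; by rewrite upd_out.
have [u eu] := psiS ((phi x : T) (sigma k)).
by have := D u; have := D (x k); rewrite eu !gdistxx; lia.
Qed.

End PermutedFactors.

Section ProductOrbits.
Variables (s : nat) (F : 'I_s -> sgraph) (m : 'I_s -> nat) (r : forall i, F i).
Hypothesis F_noniso : forall i j : 'I_s, i != j -> ~ graph_iso (F i) (F j).
Hypothesis F_conn : forall i, graph_connected (F i).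
Hypothesis F_prime : forall i, cartesian_prime (F i).
Local Notation copy := (copy m).
Local Notation FK := (fun k : copy => F (tag k)).
Local Notation T := {dffun forall k : copy, F (tag k)}.
Local Notation a := (prod_root m r).
Lemma inj_tagged i (j j' : 'I_(m i)) :
  Tagged (fun i => 'I_(m i)) j = Tagged (fun i => 'I_(m i)) j' -> j = j'.
Proof.
move=> e; have := congr1 (tagged_as (Tagged (fun i => 'I_(m i)) j)) e.
by rewrite !tagged_asE.
Qed.
Local Notation tg j := (Tagged (fun i => 'I_(m i)) j).

(** Distinct factors are not isomorphic, so such a [psi] is an automorphism of one factor; the
    cast is there because only the equality of the two indices is known. *)
Lemma iso_orbit i i' (psi : F i -> F i') :
  bijective psi -> (forall u v, adj (psi u) (psi v) = adj u v) ->
  psi (r i) = r i' ->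
  exists e : i = i', forall u,
    psi u \in orbit 'P (Aut_stab (r i')) (ecast j (F j) e u).
Proof.
move=> psiB psiA psir; have e : i = i'.
  by apply/eqP; apply: contrapT => /negP ne; apply: (F_noniso ne); exists psi.
subst i'; exists erefl => u /=; pose g := perm (bij_inj psiB).
rewrite -[psi u](permE (bij_inj psiB)); apply: (mem_orbit 'P).
by apply/Aut_stabP; split; [apply/Aut_graphP => x y|]; rewrite !permE.
Qed.

(** The permutation of the copies given by [stab_permutes_factors] respects isomorphism types,
    hence splits into one permutation for each [i]. *)
Lemma prod_stab_coords phi i :
  phi \in Aut_stab a -> exists p : {perm 'I_(m i)}, forall (x : T) j,
  (phi x : T) (tg (p j)) \in orbit 'P (Aut_stab (r i)) (x (tg j)).
Proof.
move=> phiS; have /Aut_stabP[phiA phia] := phiS.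
have [sg sgI Hsg] := stab_permutes_factors (fun k => @F_conn (tag k))
  (fun k => F_prime (tag k)) phiS.
have H (j : 'I_(m i)) : exists j' : 'I_(m i), sg (tg j) = tg j' /\
    forall x : T, (phi x : T) (tg j') \in orbit 'P (Aut_stab (r i)) (x (tg j)).
  have [psi [psiB psiA psix]] := Hsg (tg j).
  have psir : psi (r i) = r (tag (sg (tg j))).
    by have := psix a; rewrite phia !ffunE => ->.
  have [e oe] := iso_orbit psiB psiA psir.
  case: (sg (tg j)) psi psix psir e oe {psiB psiA} => i' j' psi psix psir /= e.
  subst i' => /= oe; exists j'; split=> // x; by rewrite psix.
have [p Hp] := choice H.
have pI : injective p.
  move=> j1 j2 e; have := (Hp j1).1; rewrite e -(Hp j2).1 => /sgI e'.
  exact: inj_tagged e'.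
by exists (perm pI) => x j; rewrite permE; case: (Hp j).
Qed.

(** Conversely, permuting the copies of each factor and applying root-fixing automorphisms in
    the copies is an automorphism of the product. *)
Lemma prod_orbit_coords (x y : T) (p : forall i, {perm 'I_(m i)}) :
  (forall i j, y (tg (p i j)) \in orbit 'P (Aut_stab (r i)) (x (tg j))) ->
  (y : prod_graph F m) \in orbit 'P (Aut_stab a) (x : prod_graph F m).
Proof.
move=> Hxy; have H (k : copy) : exists g : {perm F (tag k)}, g \in Aut_stab (r (tag k)) /\
    y k = g (x (tg ((p (tag k))^-1%g (tagged k)))).
  case: k => i j /=; have := Hxy i ((p i)^-1 j)%g; rewrite permKV => /orbitP[g gA e].
  by exists g.
have {H}[g Hg] : exists g : forall k : copy, {perm F (tag k)}, forall k : copy,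
    g k \in Aut_stab (r (tag k)) /\ y k = g k (x (tg ((p (tag k))^-1%g (tagged k)))).
  by exists (fun k => sval (cid (H k))) => k; case: cid.
have gA k u v : adj (g k u) (g k v) = adj u v.
  by have [/Aut_stabP[/Aut_graphP]] := Hg k.
pose f (z : T) : T := [ffun k => g k (z (tg ((p (tag k))^-1%g (tagged k))))].
have fA z w : @adj (cart FK) (f z) (f w) = @adj (cart FK) z w.
  have fE i j t : f t (tg (p i j)) = g (tg (p i j)) (t (tg j)).
    by rewrite ffunE /= permK.
  apply/cartP/cartP => [] [[i j] [zw /eqP/upd_eqP e]].
    exists (tg ((p i)^-1 j)%g); rewrite !ffunE in zw.
    split; first by move: zw; rewrite (gA (tg j)).
    apply/eqP/upd_eqP => -[i' j'] ne.
    have /e : tg (p i' j') != tg j.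
      apply: contra ne => /eqP e'; have := congr1 tag e' => /= ?; subst i'.
      by rewrite -(inj_tagged e') permK.
    by rewrite !fE => /perm_inj.
  exists (tg (p i j)); split; first by rewrite !fE (gA (tg (p i j))).
  apply/eqP/upd_eqP => -[i' j'] ne.
  rewrite !ffunE; apply: (congr1 (g (tg j'))); apply: (e (tg ((p i')^-1 j')%g)); apply: contra ne => /eqP e'.
  have := congr1 tag e' => /= ?; subst i'.
  by rewrite -[j'](permKV (p i)) (inj_tagged e').
have fI : injective f.
  move=> z w e; apply/ffunP => -[i j]; have := congr1 (fun z : T => z (tg (p i j))) e.
  by rewrite !ffunE /= => /perm_inj; rewrite permK.
have -> : y = 'P%act (x : prod_graph F m) (@perm (prod_graph F m) f fI).
  by rewrite /= /aperm permE; apply/ffunP => k; rewrite ffunE; case: (Hg k).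
apply: mem_orbit; apply/Aut_stabP; split.
  by apply/Aut_graphP => z w; rewrite !permE; apply: fA.
rewrite permE; apply/ffunP => k; rewrite !ffunE /=.
by have [/Aut_stabP[_ ->]] := Hg k.
Qed.

End ProductOrbits.

(** * Functions constant on classes, and multisets of colours *)

Section FiberSpace.
Variables (R : fieldType) (N : nat) (K : finType) (c : 'I_N -> K).

Lemma dim_fiber_space (S : {vspace 'cV[R]_N}) :
  (forall v, v \in S <-> forall i j, c i = c j -> v i 0 = v j 0) ->
  \dim S = #|(c @: [set: 'I_N])%SET|.
Proof.
move=> SP; set A := (c @: _)%SET.
pose k i := enum_rank_in (imset_f c (finset.in_setT i) : c i \in A) (c i) : 'I_#|A|.
have kE i : enum_val (k i) = c i by rewrite enum_rankK_in // imset_f.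
have kS l : exists i, k i = l.
  have /imsetP[i _ e] := enum_valP l; exists i.
  by apply: enum_val_inj; rewrite kE.
pose L (v : 'cV[R]_#|A|) : 'cV[R]_N := \col_i v (k i) 0.
have Llin : linear L by move=> b u v; apply/matrixP => i j; rewrite !mxE.
pose HL := GRing.isLinear.Build R _ _ *:%R L Llin.
pose Lm : {linear 'cV[R]_#|A| -> 'cV[R]_N} := HB.pack L HL.
have -> : S = limg (linfun Lm).
  apply/vspaceP => v; apply/idP/memv_imgP => [/SP vS|[u _ ->]].
    have [g gk] := choice kS; exists (\col_l v (g l) 0); rewrite ?memvf // lfunE /=.
    apply/matrixP => i j; rewrite !mxE [j]ord1; apply: vS.
    by rewrite -!kE gk.
  by apply/SP => i j e; rewrite lfunE /= !mxE; congr (u _ _); apply: enum_val_inj; rewrite !kE.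
rewrite limg_dim_eq ?dimvf /= ?muln1 // /dim /= ?muln1 //.
apply/eqP; rewrite -subv0; apply/subvP => v; rewrite memv_cap memv_ker memv0 => /andP[_ /eqP].
rewrite (lfunE Lm) /= => e; apply/eqP/matrixP => l j; rewrite [j]ord1.
have [i <-] := kS l; by have := congr1 (fun w : 'cV_N => w i 0) e; rewrite !mxE.
Qed.

End FiberSpace.

(** Deleting the root removes exactly one class, which is why 1 is added. *)
Lemma dim_class_space (R : fieldType) (G : sgraph) (a : G) (K : finType)
    (c : G -> K) (S : {vspace 'cV[R]_#|vdel a|}) :
  (forall k, exists x, c x = k) -> (forall x, c x = c a -> x = a) ->
  (forall v, v \in S <-> forall i j : 'I_#|vdel a|,
     c (val (enum_val i)) = c (val (enum_val j)) -> v i 0 = v j 0) ->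
  (\dim S + 1 = #|K|)%N.
Proof.
move=> cS ca SP.
have SP' v : v \in S <-> forall i j : 'I_#|vdel a|,
     (fun i : 'I_#|vdel a| => c (val (enum_val i))) i =
     (fun i : 'I_#|vdel a| => c (val (enum_val i))) j -> v i 0 = v j 0 by apply: SP.
rewrite (dim_fiber_space SP') -[RHS]cardsT [RHS](cardsD1 (c a)) inE addnC.
congr (_ + _)%N; apply: eq_card => k; rewrite !inE andbT.
apply/imsetP/idP => [[i _ ->]|ka].
  by apply: contra (valP (enum_val i)) => /eqP /ca ->.
have [x xk] := cS k; have xa : x != a by apply: contra ka => /eqP <-; rewrite xk.
by exists (enum_rank (exist _ x xa : vdel a)); rewrite ?enum_rankK.
Qed.

Section Coloring.
Variables (s : nat) (F : 'I_s -> sgraph) (m n : 'I_s -> nat).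
Variable col : forall i, F i -> 'I_(n i).+1.
Hypothesis col_surj : forall i c, exists u : F i, col u = c.
Local Notation copy := (copy m).
Local Notation T := {dffun forall k : copy, F (tag k)}.
Local Notation tg j := (Tagged (fun i => 'I_(m i)) j).

(** A multiset of size [m i] is represented by its sorted tuple, so that equality of
    multisets becomes equality and [card_sorted_tuples] counts them. *)
Definition sorted_tuple i : finType :=
  {t : (m i).-tuple 'I_(n i).+1 | sorted leq (map val t)}.

Definition ord_leq k : rel 'I_k := fun u v => (u <= v)%N.

Lemma sort_tuple_sorted i (t : (m i).-tuple 'I_(n i).+1) :
  sorted leq (map val (sort_tuple (@ord_leq _) t)).
Proof.
rewrite sorted_map; apply: sort_sorted => u v; exact: leq_total.
Qed.

Definition sort_colors i (t : (m i).-tuple 'I_(n i).+1) : sorted_tuple i :=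
  exist (fun t : (m i).-tuple 'I_(n i).+1 => is_true (sorted leq (map val t)))
    _ (sort_tuple_sorted t).

Definition multicolor (x : T) : {dffun forall i : 'I_s, sorted_tuple i} :=
  [ffun i => sort_colors [tuple @col i (x (tg j)) | j < m i]].

Lemma multicolor_eqP (x y : T) :
  multicolor x = multicolor y <->
  forall i, perm_eq [seq @col i (x (tg j)) | j : 'I_(m i)] [seq @col i (y (tg j)) | j : 'I_(m i)].
Proof.
have tot k : total (@ord_leq k) by move=> u v; exact: leq_total.
have tr k : transitive (@ord_leq k) by move=> u v w; exact: leq_trans.
have asym k : antisymmetric (@ord_leq k).
  by move=> u v uv; apply/val_inj/anti_leq.
split=> [e i|h].
  have := congr1 (fun f : {dffun forall i : 'I_s, sorted_tuple i} => val (val (f i))) e.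
  by rewrite !ffunE /= => /(perm_sortP (@tot _) (@tr _) (@asym _)).
apply/ffunP => i; rewrite !ffunE; apply/val_inj/val_inj.
exact/(perm_sortP (@tot _) (@tr _) (@asym _)).
Qed.

Lemma multicolor_surj k : exists x, multicolor x = k.
Proof.
have H (l : copy) : exists u : F (tag l), col u = tnth (val (k (tag l))) (tagged l).
  exact: col_surj.
exists [ffun l => sval (cid (H l))]; apply/ffunP => i; rewrite !ffunE.
apply/val_inj/val_inj => /=.
rewrite (_ : [seq _ | _ <- _] = val (val (k i))); last first.
  rewrite -[RHS](map_tnth_enum (val (k i))); apply: eq_map => j.
  by rewrite ffunE; case: cid.
apply: sorted_sort; first by move=> u v w; exact: leq_trans.
by have := valP (k i); rewrite sorted_map.
Qed.

Lemma card_multicolor :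
  #|{dffun forall i : 'I_s, sorted_tuple i}| = (\prod_(i < s) 'C(n i + m i, m i))%N.
Proof.
rewrite card_dep_ffun foldrE big_map big_enum /=; apply: eq_bigr => i _.
by rewrite card_sig addnC -card_sorted_tuples cardsE.
Qed.

Lemma perm_eq_colorP (x y : T) i :
  reflect (exists p : {perm 'I_(m i)}, forall j, @col i (y (tg (p j))) = @col i (x (tg j)))
    (perm_eq [seq @col i (x (tg j)) | j : 'I_(m i)] [seq @col i (y (tg j)) | j : 'I_(m i)]).
Proof.
apply: (iffP (tuple_permP (t := [tuple @col i (y (tg j)) | j < m i]))) => -[p Hp].
  exists p => j; have /eq_in_map/(_ j) := Hp.
  by rewrite mem_enum => /(_ isT) ->; rewrite tnth_map tnth_ord_tuple.
exists p; apply: eq_map => j; by rewrite tnth_map tnth_ord_tuple.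
Qed.

End Coloring.

(** * Distance cells and stabiliser orbits *)

Lemma gdist_le_diameter (G : sgraph) (x y : G) : (gdist x y <= diameter G)%N.
Proof.
by apply: leq_trans (leq_bigmax (F := fun x => \max_y gdist x y) x); apply: leq_bigmax.
Qed.

(** Some pair of vertices is at maximal distance, and transitivity moves its first member to [r]. *)
Lemma vertex_transitive_ecc (G : sgraph) (r : G) :
  graph_connected G -> vertex_transitive G -> exists y, gdist r y = diameter G.
Proof.
move=> Gc Gt; have G0 : (0 < #|G|)%N by apply/card_gt0P; exists r.
have [x ex] := @bigop.eq_bigmax G (fun x => \max_y gdist x y)%N G0.
have [y ey] := @bigop.eq_bigmax G (fun y => gdist x y) G0.
have [g gA rg] := atransP2 Gt (finset.in_setT x) (finset.in_setT r).
exists (g y); rewrite /diameter ex ey; rewrite /= /aperm in rg.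
by rewrite rg gdist_aut.
Qed.

Section DistanceCells.
Variables (R : realType) (s : nat) (F : 'I_s -> sgraph) (m : 'I_s -> nat).
Variable r : forall i, F i.
Hypothesis F_conn : forall i, graph_connected (F i).
Local Notation copy := (copy m).
Local Notation T := {dffun forall k : copy, F (tag k)}.
Local Notation a := (prod_root m r).
Local Notation tg j := (Tagged (fun i => 'I_(m i)) j).
Local Notation Q := (Q_space R m r).
Implicit Types x y : T.

Lemma same_cell_equiv : equivalence_rel (@same_cell s F m r).
Proof.
move=> x y z; split; first by apply/forallP => i.
move=> /forallP xy; apply: eq_forallb => i.
by have /permPl -> := xy i.
Qed.

Lemma same_cell_sym x y : @same_cell s F m r x y -> @same_cell s F m r y x.
Proof. by move/forallP => h; apply/forallP => i; rewrite perm_sym. Qed.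

Lemma same_cell_permP x y i :
  reflect (exists p : {perm 'I_(m i)}, forall j,
      gdist (r i) (y (tg (p j))) = gdist (r i) (x (tg j)))
    (perm_eq (coord_dists r x i) (coord_dists r y i)).
Proof.
apply: (iffP (tuple_permP (t := [tuple gdist (r i) (y (tg j)) | j < m i]))) => -[p Hp].
  exists p => j; have /eq_in_map/(_ j) := Hp.
  by rewrite mem_enum => /(_ isT) ->; rewrite tnth_map tnth_ord_tuple.
exists p; apply: eq_map => j; by rewrite tnth_map tnth_ord_tuple.
Qed.

Lemma same_cell_root x : @same_cell s F m r x a -> x = a.
Proof.
move/forallP => h; apply/ffunP => -[i j]; apply/eqP.
have /same_cell_permP[p Hp] := h i.
by rewrite eq_sym ffunE -gdist_eq0 // -Hp ffunE gdistxx.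
Qed.

(** The root is alone in its cell, so the other cells partition the deleted graph, and a
    function constant on cells is the combination of the [cell_vec] with its values as weights. *)
Lemma mem_Q_space v : v \in Q <-> forall i j : 'I_#|vdel a|,
  same_cell m r (val (enum_val i)) (val (enum_val j)) -> v i 0 = v j 0.
Proof.
pose S := span_set (fun v : 'cV[R]_#|vdel a| => forall i j : 'I_#|vdel a|,
  same_cell m r (val (enum_val i)) (val (enum_val j)) -> v i 0 = v j 0).
have SP w : w \in S <-> forall i j : 'I_#|vdel a|,
    same_cell m r (val (enum_val i)) (val (enum_val j)) -> w i 0 = w j 0.
  apply: mem_span_set => [i j _|c x y Sx Sy i j ij]; first by rewrite !mxE.
  by rewrite !mxE (Sx i j) ?(Sy i j).
have eqR : {in [set: prod_graph F m]%SET & &, equivalence_rel (@same_cell s F m r)}.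
  by move=> x y z _ _ _; exact: same_cell_equiv.
have pbE x y : (y \in finset.pblock (cells m r) x) = same_cell m r x y.
  by apply: pblock_equivalence_partition eqR _ _ _ _; rewrite inE.
have pC x : finset.pblock (cells m r) x \in cells m r.
  rewrite pblock_mem //; have /and3P[/eqP -> _ _] := equivalence_partitionP eqR.
  by rewrite inE.
have pbI x C : C \in cells m r -> x \in C -> finset.pblock (cells m r) x = C.
  have /and3P[_ tI _] := equivalence_partitionP eqR.
  exact: finset.def_pblock.
split.
  rewrite -SP; move: v; apply/subvP/span_subvP => w /mapP[C].
  rewrite mem_filter mem_enum => /andP[_ CC] -> ; apply/SP => i j ij; rewrite !mxE.
  congr (_%:R); congr nat_of_bool; apply/idP/idP => xC.
    by rewrite -(pbI _ _ CC xC) pbE.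
  by rewrite -(pbI _ _ CC xC) pbE same_cell_sym.
move=> vS.
have -> : v = \sum_(C in cells m r | a \notin C)
   (if [pick i : 'I_#|vdel a| | val (enum_val i) \in C] is Some i then v i 0 else 0)
     *: cell_vec R a C.
  apply/matrixP => i j0; rewrite [j0]ord1 summxE.
  rewrite (bigD1 (finset.pblock (cells m r) (val (enum_val i)))) /=; last first.
    rewrite pC pbE; by apply: contra (valP (enum_val i)) => /same_cell_root /eqP.
  rewrite big1 => [|C /andP[/andP[CC _] neC]]; last first.
    rewrite !mxE; case: (boolP (_ \in C)) => [iC|]; last by rewrite mulr0.
    by rewrite (pbI _ _ CC iC) eqxx in neC.
  rewrite addr0 !mxE pbE.
  case: pickP => [j|/(_ i)]; rewrite pbE; first by move=> ij; rewrite (vS i j) //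
    (_ : same_cell _ _ _ _ = true) ?mulr1 //; apply/forallP.
  by move/forallP; case => ?.
apply: memv_suml => C /andP[CC aC]; apply/memvZ/memv_span/mapP; exists C => //.
by rewrite mem_filter aC mem_enum.
Qed.

(** By transitivity every distance from 0 to the diameter occurs from [r i]: cells are
    multisets of [m i] among [diameter (F i) + 1] colours. *)
Lemma dim_Q_space : (forall i, vertex_transitive (F i)) ->
  (\dim Q + 1 = \prod_(i < s) 'C(diameter (F i) + m i, m i))%N.
Proof.
move=> F_trans.
pose col i (u : F i) : 'I_(diameter (F i)).+1 := inord (gdist (r i) u).
have colE i (u : F i) : val (col i u) = gdist (r i) u.
  by rewrite /= inordK // ltnS gdist_le_diameter.
have col_surj i c : exists u : F i, col i u = c.
  have [y ey] := vertex_transitive_ecc (r i) (@F_conn i) (@F_trans i).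
  have [|z ez] := @gdist_mid _ (@F_conn i) (r i) y c; first by rewrite ey -ltnS.
  by exists z; apply: val_inj; rewrite colE.
have cellE (x y : T) : multicolor col x = multicolor col y <-> same_cell m r x y.
  have E (z : T) i : coord_dists r z i =
      map val [seq col i (z (tg j)) | j : 'I_(m i)].
    by rewrite -map_comp; apply: eq_map => j /=; rewrite -colE.
  rewrite multicolor_eqP; split => [h|/forallP h i].
    by apply/forallP => i; rewrite !E perm_map.
  by have := h i; rewrite !E => /(perm_map_inj val_inj).
rewrite -(card_multicolor m); apply: (@dim_class_space R (prod_graph F m) a _ (@multicolor _ _ _ _ col)).
- exact: multicolor_surj.
- by move=> x /cellE /same_cell_root.
by move=> v; rewrite mem_Q_space; split=> h i j /cellE; apply: h.
Qed.

End DistanceCells.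

Section Orbits.
Variables (R : realType) (s : nat) (F : 'I_s -> sgraph) (m : 'I_s -> nat).
Variable r : forall i, F i.
Hypothesis F_noniso : forall i j : 'I_s, i != j -> ~ graph_iso (F i) (F j).
Hypothesis F_conn : forall i, graph_connected (F i).
Hypothesis F_prime : forall i, cartesian_prime (F i).
Local Notation copy := (copy m).
Local Notation T := {dffun forall k : copy, F (tag k)}.
Local Notation a := (prod_root m r).
Local Notation tg j := (Tagged (fun i => 'I_(m i)) j).
Implicit Types x y : prod_graph F m.

Lemma orbit_same_cell x y :
  y \in orbit 'P (Aut_stab a) x -> same_cell m r x y.
Proof.
case/orbitP => phi phiS <-; apply/forallP => i; apply/same_cell_permP.
have [p Hp] := prod_stab_coords F_noniso F_conn F_prime i phiS; exists p => j.
have /orbitP[g /Aut_stabP[gA gr] /= <-] := Hp (x : T) j.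
by rewrite -{1}gr gdist_aut.
Qed.

Lemma Q_sub_U : (Q_space R m r <= U_space R a)%VS.
Proof.
apply/subvP => v /(mem_Q_space F_conn) vQ; apply/mem_U_space => i j ij.
exact/vQ/orbit_same_cell.
Qed.

(** Two vertices are in one orbit exactly when, for each [i], their coordinates lie in the
    same multiset of orbits of the stabiliser of [r i]. *)
Lemma dim_U_space :
  (\dim (U_space R a) + 1 = \prod_(i < s) 'C(num_orbits (r i) + m i - 1, m i))%N.
Proof.
pose orb i (u : F i) := orbit 'P (Aut_stab (r i)) u.
pose O i := (orbit 'P (Aut_stab (r i)) @: [set: F i])%SET.
have O_in i u : orb i u \in O i by apply: imset_f; rewrite inE.
have O_gt0 i : (0 < #|O i|)%N by apply/card_gt0P; exists (orb i (r i)); apply: O_in.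
pose rk i (u : F i) : 'I_#|O i| := enum_rank_in (O_in i u) (orb i u).
have rkK i (u : F i) : enum_val (rk i u) = orb i u.
  by rewrite enum_rankK_in //; apply: O_in.
pose col i (u : F i) : 'I_(#|O i|.-1).+1 := inord (rk i u).
have colE i (u v : F i) : col i u = col i v <-> v \in orb i u.
  split=> [/(congr1 val)|uv].
    rewrite /= !inordK ?prednK // => /ord_inj e.
    by rewrite -rkK e rkK; apply: orbit_refl.
  congr (inord (val _)); apply: enum_val_inj; rewrite !rkK.
  by apply/esym/eqP; rewrite orbit_eq_mem.
have col_surj i c : exists u : F i, col i u = c.
  have /imsetP[u _ eu] := enum_valP (cast_ord (prednK (O_gt0 i)) c).
  exists u; rewrite /col (_ : rk i u = cast_ord (prednK (O_gt0 i)) c).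
    by rewrite /= inord_val.
  by apply: enum_val_inj; rewrite rkK; apply: esym; exact: eu.
have orbE (x y : T) : multicolor col x = multicolor col y <->
    (y : prod_graph F m) \in orbit 'P (Aut_stab a) (x : prod_graph F m).
  rewrite multicolor_eqP; split=> [h|/orbitP[phi phiS <-] i].
    pose H i := cid (perm_eq_colorP col x y i (h i)).
    apply: (prod_orbit_coords (p := fun i => sval (H i))) => i j.
    by apply/colE; rewrite (svalP (H i)).
  have [p Hp] := prod_stab_coords F_noniso F_conn F_prime i phiS.
  by apply/perm_eq_colorP; exists p => j; apply/esym/colE/Hp.
transitivity (\prod_(i < s) 'C(#|O i|.-1 + m i, m i))%N; last first.
  apply: eq_bigr => i _; rewrite /num_orbits -/(O i); have := O_gt0 i.
  by case: #|O i| => // k _; rewrite addSn subn1.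
rewrite -(card_multicolor m); apply: (@dim_class_space R (prod_graph F m) a _ (@multicolor _ _ _ _ col)).
- exact: multicolor_surj.
- move=> x /esym/orbE /orbitP[phi /Aut_stabP[_ pa]].
  by rewrite /= /aperm pa.
by move=> v; rewrite mem_U_space; split=> h i j /orbE; apply: h.
Qed.

End Orbits.

(** * Real symmetric matrices and the spectrum seen from a root *)

Lemma hermitian_mxminpoly (C : numClosedFieldType) n (B : 'M[C]_n.+1) :
  B \is hermsymmx ->
  mxminpoly B = mxminpoly (diag_mx (spectral_diag B)).
Proof.
move/hermitian_normalmx/orthomx_spectralP => BE.
have u : spectralmx B \in unitmx := spectral_unit B.
have uV : invmx (spectralmx B) \in unitmx by rewrite unitmx_inv.
have := mxminpoly_uconj (diag_mx (spectral_diag B)) uV.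
by rewrite (conjVmx _ u) -BE.
Qed.

(** Over R[i] the matrix is Hermitian, so its minimal polynomial is a product of distinct
    factors with real roots. Minimal polynomials do not change under field extension, so this
    factorization holds over R as well, where it means diagonalizability. *)
Lemma symmetric_eigen_sum (R : rcfType) n (A : 'M[R]_n) : A^T = A ->
  exists2 rs, uniq rs & (1%:M <= \sum_(t <- rs) eigenspace A t)%MS.
Proof.
case: n A => [|n] A Asym; first by exists [::]; rewrite // [1%:M]flatmx0 sub0mx.
pose f := real_complex R; pose B := map_mx f A.
have Bherm : B \is hermsymmx.
  apply/is_hermitianmxP; rewrite expr0 scale1r; apply/matrixP => i j.
  rewrite !mxE -[in RHS]Asym mxE.
  by apply/esym/CrealP/complex_realP; exists (A i j).
have dR i : exists x, spectral_diag B 0 i = f x.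
  by apply/complex_realP; have /mxOverP := hermitian_spectral_diag_real Bherm.
have mB := hermitian_mxminpoly Bherm.
move: (spectral_diag B) dR mB => d dR mB; have [x xE] := choice dR.
have {}xE : [seq d 0 i | i <- enum 'I_n.+1] = map f [seq x i | i <- enum 'I_n.+1].
  by rewrite -map_comp; apply: eq_map => i; rewrite xE.
pose rs := undup [seq x i | i <- enum 'I_n.+1].
have mA : mxminpoly A = \prod_(t <- rs) ('X - t%:P).
  apply: (map_poly_inj f); rewrite -mxminpoly_map mB mxminpoly_diag.
  rewrite rmorph_prod (eq_bigr (fun t => 'X - (f t)%:P)); last first.
    by move=> t _; rewrite rmorphB /= map_polyX map_polyC.
  rewrite -(big_map f xpredT (fun t => 'X - t%:P)); congr (\big[_/_]_(_ <- _) _).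
  rewrite /rs -undup_map_inj; last exact: (fmorph_inj f).
  by rewrite xE.
have /diagonalizablePeigen[qs qsu qsE] : diagonalizable A.
  by apply/diagonalizableP; exists rs; [exact: undup_uniq | rewrite mA dvdpp].
by exists qs; [exact: qsu | rewrite qsE submx_refl].
Qed.

Section OrthoReal.
Variables (R : realFieldType) (n : nat).
Implicit Types (u w : 'rV[R]_n) (A W : 'M[R]_n).

Lemma mul_rV_tr_eq0 u : u *m u^T = 0 -> u = 0.
Proof.
move/matrixP/(_ 0 0); rewrite !mxE => /eqP.
rewrite psumr_eq0 => [/allP h|i _]; last by rewrite mxE -expr2 sqr_ge0.
apply/rowP => i; have := h i (mem_index_enum i); rewrite !mxE -expr2 sqrf_eq0.
by move/eqP.
Qed.

Lemma ortho1P u W :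
  reflect (u *m W^T = 0) (u <= orthomx idfun 1%:M W)%MS.
Proof.
have E : map_mx idfun W^T = W^T by apply/matrixP => i j; rewrite !mxE.
by apply: (iffP sub_kermxP); rewrite mul1mx E.
Qed.

Lemma ortho1_disj W : (W :&: orthomx idfun 1%:M W = 0)%MS.
Proof.
apply/eqP; rewrite -submx0; apply/rV_subP => u.
rewrite sub_capmx submx0 => /andP[/submxP[c uc] /ortho1P uW].
by apply/eqP/mul_rV_tr_eq0; rewrite {2}uc trmx_mul mulmxA uW mul0mx.
Qed.

Lemma ortho1_full W u : (u <= W + orthomx idfun 1%:M W)%MS.
Proof.
apply: submx_full; rewrite /row_full mxrank_disjoint_sum ?ortho1_disj //.
rewrite /orthomx mxrank_ker mul1mx mxrank_map mxrank_tr subnKC // rank_leq_col //.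
Qed.

Lemma eigen_ortho k A s t u (w : 'M[R]_(k, n)) : A^T = A -> s != t ->
  u *m A = s *: u -> w *m A = t *: w -> u *m w^T = 0.
Proof.
move=> As st uA wA; apply/eqP; have : s *: (u *m w^T) = t *: (u *m w^T).
  by rewrite scalemxAl -uA -mulmxA -{1}As -trmx_mul wA linearZ /= -scalemxAr.
move/eqP; rewrite -subr_eq0 -scalerBl scaler_eq0 subr_eq0 (negPf st).
by [].
Qed.

End OrthoReal.

Section RootSpectrum.
Variables (R : realType) (G : sgraph) (r : G).
Local Notation A := (adjmx R G).
Local Notation rp := (@root_proj R G r).

Lemma adjmx_sym : A^T = A.
Proof. by apply/matrixP => i j; rewrite !mxE adj_sym. Qed.

Lemma root_proj_eigen t : rp t *m A = t *: rp t.
Proof. exact/eigenspaceP/proj_mx_sub. Qed.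

(** The difference between the root vector and its projection is orthogonal to the projection. *)
Lemma root_proj_norm t : rp t 0 (enum_rank r) = @omega R G r t.
Proof.
have /ortho1P := proj_mx_compl_sub (ortho1_full (eigenspace A t) (delta_mx 0 (enum_rank r))).
rewrite -/(eigenproj G t) -/(root_proj r t) => h.
have /submxP[c rc] : (rp t <= eigenspace A t)%MS by apply: proj_mx_sub.
have : (delta_mx 0 (enum_rank r) - rp t) *m (rp t)^T = 0.
  by rewrite {2}rc trmx_mul mulmxA h mul0mx.
rewrite mulmxBl => /eqP; rewrite subr_eq0 => /eqP /matrixP /(_ 0 0).
rewrite -rowE !mxE => ->; apply: eq_bigr => i _; by rewrite [_^T _ _]mxE expr2.
Qed.

Lemma omega_ge0 t : 0 <= @omega R G r t.
Proof. by apply: sumr_ge0 => i _; apply: sqr_ge0. Qed.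

Lemma omega_eq0 t : (@omega R G r t == 0) = (rp t == 0).
Proof.
rewrite /omega psumr_eq0 => [|i _]; last exact: sqr_ge0.
apply/allP/eqP => [h|-> i _]; last by rewrite /= mxE expr0n /=.
apply/rowP => i; have := h i (mem_index_enum i).
by rewrite /= sqrf_eq0 => /eqP ->; rewrite mxE.
Qed.

(** Eigenspaces of a symmetric matrix are mutually orthogonal, so the components of the root
    vector in the sum of all eigenspaces are its orthogonal projections. *)
Lemma root_proj_decomp : exists2 rs : seq R, uniq rs &
  (forall t, Theta R r t -> t \in rs) /\
  \sum_(t <- rs) rp t = delta_mx 0 (enum_rank r).
Proof.
have [rs rsu rsE] := symmetric_eigen_sum adjmx_sym.
exists rs => //; set e := delta_mx 0 (enum_rank r).
have : (e <= \sum_(t <- rs) eigenspace A t)%MS by apply: submx_trans rsE; apply: submx1.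
rewrite (big_nth 0) big_mkord => /sub_sumsmxP[u_ ue].
pose w i := u_ i *m eigenspace A rs`_i.
have wE i : (w i <= eigenspace A rs`_i)%MS by apply: submxMl.
have wA i : w i *m A = rs`_i *: w i by apply/eigenspaceP.
have pj t (i : 'I_(size rs)) : rs`_i != t -> w i *m eigenproj G t = 0.
  move=> ne; apply: proj_mx_0; first exact: ortho1_disj.
  apply/ortho1P; apply: eigen_ortho adjmx_sym ne (wA i) _.
  exact/eigenspaceP/submx_refl.
have pi (i : 'I_(size rs)) : rp rs`_i = w i.
  rewrite /root_proj -/e ue mulmx_suml (bigD1 i) //= -/(w i).
  rewrite proj_mx_id ?ortho1_disj // big1 ?addr0 // => j ji; apply: pj.
  by rewrite nth_uniq.
split=> [t tT|].
  apply: contraPT tT => tn; apply/negP; rewrite negbK; apply/eqP.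
  rewrite /root_proj -/e ue mulmx_suml big1 // => i _; apply: pj.
  by apply: contra tn => /eqP <-; apply: mem_nth.
by rewrite (big_nth 0) big_mkord ue; apply: eq_bigr => i _; exact: pi.
Qed.

End RootSpectrum.

(** * Filtering coefficients by eigenvalues *)

Section SpectralFilter.
Variables (R : fieldType) (J : Type) (S : (J -> R) -> Prop).
Hypothesis S_lin : forall a c e, S c -> S e -> S (fun j => a * c j + e j).
Implicit Types c e : J -> R.

Lemma filter_prod (I : Type) (mu : I -> J -> R) (k : I -> R) (L : seq I) :
  (forall i c, S c -> S (fun j => mu i j * c j)) ->
  forall c, S c -> S (fun j => (\prod_(i <- L) (mu i j - k i)) * c j).
Proof.
move=> Smu c Sc; elim: L => [|i L IH].
  by move: Sc; congr S; apply/funext => j; rewrite big_nil mul1r.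
have := S_lin (- k i) IH (Smu i _ IH); congr S; apply/funext => j.
by rewrite big_cons; ring.
Qed.

End SpectralFilter.

(** Lagrange interpolation on the finite set of values of [mu]. The predicate [S] is meant to be
    a condition on the coefficients of an expansion in eigenvectors that is stable under the
    operator with eigenvalues [mu]; it is then stable under every function of that operator. *)
Lemma spectral_filter (R : fieldType) (J : finType) (S : (J -> R) -> Prop) (mu : J -> R) :
  (forall a c e, S c -> S e -> S (fun j => a * c j + e j)) ->
  (forall c, S c -> S (fun j => mu j * c j)) ->
  forall g c, S c -> S (fun j => g (mu j) * c j).
Proof.
move=> S_lin Smu g c Sc.
have S0 : S (fun _ => 0).
  by have := S_lin (-1) _ _ Sc Sc; congr S; apply/funext => j; rewrite mulN1r addNr.
pose V := undup [seq mu j | j : J].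
have VmuP j : mu j \in V by rewrite mem_undup; apply: map_f; rewrite mem_enum.
have ind l : l \in V -> S (fun j => (mu j == l)%:R * c j).
  move=> lV; pose L := [seq x <- V | x != l].
  have := filter_prod (I := R) S_lin (mu := fun _ j => mu j) id L (fun _ => Smu) Sc.
  pose k := (\prod_(x <- L) (l - x))^-1.
  move/(S_lin k) => /(_ _ S0); congr S; apply/funext => j; rewrite addr0.
  have [-> |ne] := eqVneq (mu j) l.
    rewrite mulrA mulVf // prodf_seq_neq0; apply/allP => x.
    by rewrite mem_filter subr_eq0 eq_sym => /andP[].
  rewrite (big_rem (mu j)) /= ?subrr ?mul0r ?mulr0 //.
  by rewrite mem_filter ne VmuP.
suff H (L : seq R) : {subset L <= V} -> S (fun j => (\sum_(l <- L) g l * (mu j == l)%:R) * c j).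
  have := H V (fun x h => h); congr S; apply/funext => j.
  rewrite (bigD1_seq (mu j)) ?undup_uniq //= eqxx mulr1 big1 ?addr0 // => x.
  by rewrite eq_sym => /negPf ->; rewrite mulr0.
elim: L => [|x L IH] sub.
  by move: S0; congr S; apply/funext => j; rewrite big_nil mul0r.
have Sx := ind x (sub x (mem_head _ _)).
have SL := IH (fun y h => sub y (mem_behead (s := x :: L) h)).
have := S_lin (g x) _ _ Sx SL; congr S; apply/funext => j.
by rewrite big_cons; ring.
Qed.

(** The version for commuting operators. Filtering by one index after the other isolates a
    joint eigenvalue, and [f] is a combination of the indicators obtained in this way. *)
Lemma joint_spectral_filter (R : numFieldType) (J I : finType)
    (S : (J -> R) -> Prop) (mu : I -> J -> R) :
  (forall a c e, S c -> S e -> S (fun j => a * c j + e j)) ->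
  (forall i c, S c -> S (fun j => mu i j * c j)) ->
  forall (f : (I -> R) -> R) c, S c -> S (fun j => f (mu^~ j) * c j).
Proof.
move=> S_lin Smu f c Sc.
have S0 : S (fun _ => 0).
  by have := S_lin (-1) _ _ Sc Sc; congr S; apply/funext => j; rewrite mulN1r addNr.
pose eqv j0 j := [forall i, mu i j == mu i j0].
have ind j0 : S (fun j => (eqv j0 j)%:R * c j).
  have H (L : seq I) : S (fun j => (all (fun i => mu i j == mu i j0) L)%:R * c j).
    elim: L => [|i L IH]; first by move: Sc; congr S; apply/funext => j; rewrite mul1r.
    have := spectral_filter S_lin (Smu i) (fun x => (x == mu i j0)%:R) IH.
    by congr S; apply/funext => j; rewrite /= mulrA -natrM mulnb.
  have := H (enum I); congr S; apply/funext => j; congr (_%:R * _); congr nat_of_bool.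
  by apply/allP/forallP => h i; [apply: h; rewrite mem_enum | move=> _; apply: h].
pose N j0 : R := \sum_j (eqv j0 j)%:R.
have N_neq0 j0 : N j0 != 0.
  rewrite /N -natr_sum pnatr_eq0 -lt0n (bigD1 j0) //=.
  by rewrite (_ : eqv j0 j0) //; apply/forallP.
have mu_eqv j0 j : eqv j0 j -> mu^~ j0 = mu^~ j.
  by move/forallP => h; apply/funext => i; apply/esym/eqP.
have NE j0 j : eqv j0 j -> N j0 = N j.
  move=> e; apply: eq_bigr => l _; rewrite /eqv; congr (nat_of_bool _)%:R.
  by apply: eq_forallb => i; rewrite (congr1 (fun g => g i) (mu_eqv _ _ e)).
have eqvC j0 j : eqv j0 j = eqv j j0 by apply: eq_forallb => i; rewrite eq_sym.
have H (L : seq J) : S (fun j => (\sum_(j0 <- L) f (mu^~ j0) / N j0 * (eqv j0 j)%:R) * c j).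
  elim: L => [|j0 L IH]; first by move: S0; congr S; apply/funext => j; rewrite big_nil mul0r.
  have := S_lin (f (mu^~ j0) / N j0) _ _ (ind j0) IH; congr S; apply/funext => j.
  by rewrite big_cons mulrDl mulrA.
have := H (index_enum J); congr S; apply/funext => j; congr (_ * _).
rewrite (eq_bigr (fun j0 => f (mu^~ j) / N j * (eqv j j0)%:R)) => [|j0 _].
  by rewrite -mulr_sumr -/(N j) divfK.
rewrite eqvC; case: (boolP (eqv j j0)) => [e|]; last by rewrite !mulr0.
by rewrite -(mu_eqv _ _ e) (NE _ _ e).
Qed.

(** * Moments of the root spectrum of a product *)

Section Moments.
Variables (R : realType) (K : finType) (n t : nat) (th : 'I_n -> R).
Variables (w : K -> 'I_n -> R) (d : K -> R) (cl : K -> 'I_t).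
Hypothesis d_gt0 : forall k, 0 < d k.
Hypothesis w_ge0 : forall k j, 0 <= w k j.
Hypothesis w_sum1 : forall k, \sum_j w k j = 1.
Hypothesis w_mean0 : forall k, \sum_j w k j * th j = 0.

(** Derivative of order [p] of the exponential generating function of the root spectrum. *)
Definition exp_moment (p : nat) k (z : R) := \sum_j w k j * th j ^+ p * expR (z * th j).
Definition boundary_fun k (z : R) := (d k)^-1 * (exp_moment 1 k z / exp_moment 0 k z).
Hypothesis clP : forall k l, cl k = cl l <-> boundary_fun k = boundary_fun l.

Implicit Types (tau : {ffun K -> 'I_n}) (k l : K) (z : K -> R).
Definition joint_weight tau := \prod_k w k (tau k).
Definition eig_sum tau := \sum_k th (tau k).
Definition class_sum tau g := \sum_(k | cl k == g) th (tau k).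

Lemma exp_moment0_gt0 k (z : R) : 0 < exp_moment 0 k z.
Proof.
have [j wj] : exists j, 0 < w k j.
  apply: contrapT => h; have := w_sum1 k; rewrite big1 => [/esym/eqP|j _].
    by rewrite oner_eq0.
  by apply: le_anti; rewrite w_ge0 andbT leNgt; apply/negP => wj; apply: h; exists j.
rewrite /exp_moment (bigD1 j) //= ltr_pwDl //.
  by rewrite expr0 mulr1 mulr_gt0 // expR_gt0.
by apply: sumr_ge0 => i _; rewrite expr0 mulr1 mulr_ge0 // expR_ge0.
Qed.

(** The generating function of a sum of independent choices is a product. *)
Lemma sum_expR_gen (p : K -> nat) z :
  \sum_tau joint_weight tau * (\prod_k th (tau k) ^+ p k) * expR (\sum_k z k * th (tau k))
  = \prod_k exp_moment (p k) k (z k).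
Proof.
rewrite /exp_moment bigA_distr_bigA; apply: eq_bigr => tau _.
by rewrite expR_sum -!big_split.
Qed.

Lemma sum_expR1 k z :
  \sum_tau joint_weight tau * th (tau k) * expR (\sum_l z l * th (tau l))
  = d k * boundary_fun k (z k) * \prod_l exp_moment 0 l (z l).
Proof.
transitivity (\prod_l exp_moment (l == k) l (z l)).
  rewrite -sum_expR_gen; apply: eq_bigr => tau _; congr (_ * _ * _).
  rewrite (bigD1 k) //= eqxx expr1 big1 ?mulr1 // => l /negPf ->.
  exact: expr0.
rewrite (bigD1 k) //= [in RHS](bigD1 k) //= eqxx.
rewrite (eq_bigr (fun l => exp_moment 0 l (z l))) => [|l /negPf -> //].
rewrite /boundary_fun; set q := \prod_(_ | _) _; field.
by rewrite !gt_eqF ?exp_moment0_gt0.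
Qed.

(** The variance form of the derivative of [boundary_fun]. *)
Definition boundary_deriv k (z : R) :=
  (exp_moment 2 k z / exp_moment 0 k z - (exp_moment 1 k z / exp_moment 0 k z) ^+ 2)
    / d k.

Lemma sum_expR2 k l z :
  \sum_tau joint_weight tau * (th (tau k) * th (tau l)) * expR (\sum_l z l * th (tau l))
  = (d k * boundary_fun k (z k) * (d l * boundary_fun l (z l))
      + (k == l)%:R * (d k * boundary_deriv k (z k)))
    * \prod_l exp_moment 0 l (z l).
Proof.
have d0 i : d i != 0 by rewrite gt_eqF.
have p0 i : exp_moment 0 i (z i) != 0 by rewrite gt_eqF ?exp_moment0_gt0.
transitivity (\prod_i exp_moment ((i == k) + (i == l)) i (z i)).
  rewrite -sum_expR_gen; apply: eq_bigr => tau _; congr (_ * _ * _).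
  rewrite (eq_bigr (fun i => th (tau i) ^+ (i == k) * th (tau i) ^+ (i == l))) => [|i _]; last by rewrite exprD.
  rewrite big_split (bigD1 k) //= eqxx expr1 big1 ?mulr1 => [|i /negPf -> //].
  by rewrite (bigD1 l) //= eqxx expr1 big1 ?mulr1 // => i /negPf ->.
have [<-{l}|kl] := eqVneq k l.
  rewrite (bigD1 k) //= [in RHS](bigD1 k) //= eqxx.
  rewrite (eq_bigr (fun l => exp_moment 0 l (z l))) => [|l /negPf -> //].
  rewrite /boundary_fun /boundary_deriv mul1r /=; set q := \prod_(_ | _) _; field.
  by rewrite d0 p0.
rewrite (bigD1 k) //= [in RHS](bigD1 k) //= eqxx (negPf kl).
rewrite (bigD1 l) 1?eq_sym //= [in RHS](bigD1 l) 1?eq_sym //= eqxx eq_sym (negPf kl) /=.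
rewrite (eq_bigr (fun l => exp_moment 0 l (z l))) => [|i /andP[/negPf -> /negPf ->] //].
rewrite /boundary_fun /boundary_deriv mul0r /=; set q := \prod_(_ | _) _; field.
by rewrite !d0 !p0.
Qed.

Lemma is_derive_exp_moment p k (z : R) :
  is_derive z (1 : R) (exp_moment p k) (exp_moment p.+1 k z).
Proof.
have -> : exp_moment p k = \sum_(j < n) ((w k j * th j ^+ p) \*: (expR \o (th j \*: id))).
  apply/funext => x; rewrite /exp_moment fct_sumE; apply: eq_bigr => j _.
  by rewrite /= /GRing.scale /= [x * _]mulrC.
have -> : exp_moment p.+1 k z = \sum_(j < n) (w k j * th j ^+ p) *: (expR (th j *: z) * (th j *: 1)).
  apply: eq_bigr => j _; rewrite /GRing.scale /= [z * _]mulrC exprSr; ring.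
apply: is_derive_sum => j; apply: is_deriveZ; apply: is_derive1_comp.
Qed.

Lemma is_derive_boundary k (z : R) : is_derive z (1 : R) (boundary_fun k) (boundary_deriv k z).
Proof.
have p0 : exp_moment 0 k z != 0 by rewrite gt_eqF ?exp_moment0_gt0.
have d0 : d k != 0 by rewrite gt_eqF.
have -> : boundary_fun k = (d k)^-1 \*: (exp_moment 1 k * (fun x => (exp_moment 0 k x)^-1)).
  by apply/funext => x.
have -> : boundary_deriv k z = (d k)^-1 *: (exp_moment 1 k z *: (- (exp_moment 0 k z) ^- 2 *: exp_moment 1 k z) +
    (exp_moment 0 k z)^-1 *: exp_moment 2 k z).
  by rewrite /boundary_deriv /GRing.scale /=; field; rewrite d0 p0.
apply: is_deriveZ; apply: is_deriveM; first exact: is_derive_exp_moment.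
by apply: is_deriveV => //; apply: is_derive_exp_moment.
Qed.

Lemma boundary_fun0 k : boundary_fun k 0 = 0.
Proof.
rewrite /boundary_fun /exp_moment (eq_bigr (fun j => w k j * th j)) => [|j _].
  by rewrite w_mean0 mul0r mulr0.
by rewrite mul0r expR0 mulr1 expr1.
Qed.

(** All boundary functions vanish at 0, because the weights have mean 0 (an adjacency matrix
    has zero diagonal); so two of them with equal derivatives coincide. *)
Lemma boundary_deriv_sep k l :
  cl k <> cl l -> exists x : R, boundary_deriv k x != boundary_deriv l x.
Proof.
move=> kl; apply: contrapT => h; apply: kl; apply/clP; apply/funext => z.
have D (x : R) : is_derive x (1 : R) (boundary_fun k - boundary_fun l) 0.
  have e : boundary_deriv k x = boundary_deriv l x by apply: contrapT => /eqP ne; apply: h; exists x.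
  rewrite -(subrr (boundary_deriv k x)) {2}e; apply: is_deriveB; exact: is_derive_boundary.
have := is_derive_0_is_cst z 0 D.
by rewrite !fctE !boundary_fun0 subrr => /eqP; rewrite subr_eq0 => /eqP.
Qed.

Definition class_valency g := \sum_(k | cl k == g) d k.

Lemma class_sum_expR (z : 'I_t -> R) tau :
  \sum_g z g * class_sum tau g = \sum_k z (cl k) * th (tau k).
Proof.
rewrite [RHS](partition_big cl xpredT) //=; apply: eq_bigr => g _.
by rewrite mulr_sumr; apply: eq_bigr => k /eqP ->.
Qed.

(** Within a class the generating functions of both sides agree, with one free variable per
    class: this is [sum_expR1]. Increasing the variable of class [h] by 1 multiplies the
    coefficients by the exponential of [class_sum tau h], so [joint_spectral_filter] turns the
    identity of generating functions into one for each value of the vector of class sums. *)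
Lemma class_moment_eq (f : ('I_t -> R) -> R) k l : cl k = cl l ->
  d l * (\sum_tau joint_weight tau * th (tau k) * f (class_sum tau)) =
  d k * (\sum_tau joint_weight tau * th (tau l) * f (class_sum tau)).
Proof.
move=> kl; pose c tau := joint_weight tau * (d l * th (tau k) - d k * th (tau l)).
pose S (c : {ffun K -> 'I_n} -> R) := forall z : 'I_t -> R,
  \sum_tau c tau * expR (\sum_g z g * class_sum tau g) = 0.
have S_lin a c1 c2 : S c1 -> S c2 -> S (fun j => a * c1 j + c2 j).
  move=> S1 S2 z; rewrite (eq_bigr (fun tau => a * (c1 tau * expR (\sum_g z g * class_sum tau g)) +
     c2 tau * expR (\sum_g z g * class_sum tau g))) => [|tau _]; last by ring.
  by rewrite big_split /= -mulr_sumr S1 S2 mulr0 addr0.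
have Smu h c1 : S c1 -> S (fun tau => expR (class_sum tau h) * c1 tau).
  move=> S1 z; rewrite -[RHS](S1 (fun g => z g + (g == h)%:R)).
  apply: eq_bigr => tau _.
  have -> : \sum_g (z g + (g == h)%:R) * class_sum tau g = class_sum tau h + \sum_g z g * class_sum tau g.
    rewrite (eq_bigr (fun g => z g * class_sum tau g + (if g == h then class_sum tau h else 0))).
      by rewrite big_split /= -big_mkcond big_pred1_eq addrC.
    move=> g _; rewrite mulrDl; have [->|] := eqVneq g h; first by rewrite mul1r.
    by rewrite mul0r.
  by rewrite expRD; ring.
have Sc : S c.
  move=> z; rewrite /c.
  rewrite (eq_bigr (fun tau =>
     d l * (joint_weight tau * th (tau k) * expR (\sum_k z (cl k) * th (tau k))) -
     d k * (joint_weight tau * th (tau l) * expR (\sum_k z (cl k) * th (tau k))))) => [|tau _]; last first.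
    by rewrite class_sum_expR; ring.
  rewrite sumrB -!mulr_sumr !(sum_expR1 _ (fun k => z (cl k))).
  by rewrite kl (clP k l).1 //; ring.
(* The filter sees the class sums through expR; ln undoes this. *)
have Scf : S (fun tau => f (class_sum tau) * c tau).
  have := joint_spectral_filter S_lin Smu (fun y => f (fun g => ln (y g))) Sc.
  congr S; apply/funext => tau; congr (f _ * _).
  by apply/funext => g; rewrite expRK.
apply/eqP; rewrite -subr_eq0 !mulr_sumr -sumrB; apply/eqP.
rewrite -[RHS](Scf (fun _ => 0)); apply: eq_bigr => tau _.
rewrite big1 ?expR0 => [|g _]; last by rewrite mul0r.
by rewrite /c; ring.
Qed.

(** Averaging [class_moment_eq] over the class of [k]. *)
Lemma class_moment (f : ('I_t -> R) -> R) k :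
  class_valency (cl k) * (\sum_tau joint_weight tau * th (tau k) * f (class_sum tau)) =
  d k * (\sum_tau joint_weight tau * class_sum tau (cl k) * f (class_sum tau)).
Proof.
rewrite /class_valency mulr_suml.
rewrite (eq_bigr (fun l => d k * (\sum_tau joint_weight tau * th (tau l) * f (class_sum tau)))); last first.
  by move=> l /eqP e; apply: class_moment_eq.
rewrite -mulr_sumr exchange_big /=; congr (_ * _); apply: eq_bigr => tau _.
by rewrite /class_sum mulr_sumr mulr_suml.
Qed.

Definition total_moment (z : R) := \prod_l exp_moment 0 l z.

Lemma eig_sum_class_sum tau : eig_sum tau = \sum_g class_sum tau g.
Proof. by rewrite /eig_sum (partition_big cl xpredT). Qed.

Lemma first_moment k (z : R) :
  \sum_tau joint_weight tau * class_sum tau (cl k) * expR (z * eig_sum tau) =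
  total_moment z * class_valency (cl k) * boundary_fun k z.
Proof.
rewrite /class_sum (eq_bigr (fun tau => \sum_(l | cl l == cl k)
   joint_weight tau * th (tau l) * expR (\sum_i z * th (tau i)))) => [|tau _]; last first.
  by rewrite mulr_sumr mulr_suml /eig_sum mulr_sumr.
rewrite exchange_big /= /class_valency !(mulr_sumr, mulr_suml); apply: eq_bigr => l /eqP e.
rewrite (sum_expR1 l (fun=> z)) /total_moment (clP l k).1 //; ring.
Qed.

(** Mixed terms factor through the boundary functions; each diagonal term contributes in
    addition a variance, and these add up to the derivative of the common boundary function. *)
Lemma second_moment k (b : 'I_t -> R) (z : R) :
  \sum_tau joint_weight tau * class_sum tau (cl k) *
    (expR (z * eig_sum tau) * \sum_h b h * class_sum tau h) =
  total_moment z * class_valency (cl k) *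
    (boundary_fun k z * (\sum_l b (cl l) * d l * boundary_fun l z)
      + b (cl k) * boundary_deriv k z).
Proof.
have et'E l : cl l = cl k -> boundary_deriv l z = boundary_deriv k z.
  move=> e; have E := (clP l k).1 e.
  have := is_derive_boundary l z; rewrite E => D1; have := is_derive_boundary k z => D2.
  by rewrite -(derive_val (is_derive := D1)) -(derive_val (is_derive := D2)).
have bE tau : \sum_h b h * class_sum tau h = \sum_l b (cl l) * th (tau l) by apply: class_sum_expR.
rewrite (eq_bigr (fun tau => \sum_(l | cl l == cl k) \sum_i b (cl i) *
   (joint_weight tau * (th (tau l) * th (tau i)) * expR (\sum_i z * th (tau i))))) => [|tau _]; last first.
  rewrite bE /class_sum /eig_sum [z * _]mulr_sumr; set E := expR _.
  rewrite [joint_weight tau * _]mulr_sumr mulr_suml; apply: eq_bigr => l _.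
  by rewrite !mulr_sumr; apply: eq_bigr => i _; ring.
rewrite exchange_big /= /class_valency !(mulr_sumr, mulr_suml); apply: eq_bigr => l /eqP e.
rewrite exchange_big /= (eq_bigr (fun i => b (cl i) * (
  (d l * boundary_fun l z * (d i * boundary_fun i z) + (l == i)%:R * (d l * boundary_deriv l z)) * total_moment z))); last first.
  by move=> i _; rewrite -mulr_sumr (sum_expR2 l i (fun=> z)).
rewrite (eq_bigr (fun i => total_moment z * d l * boundary_fun k z * (b (cl i) * d i * boundary_fun i z) +
    total_moment z * d l * (if i == l then b (cl k) * boundary_deriv k z else 0))); last first.
  move=> i _; rewrite eq_sym; have [->|ne] := eqVneq i l.
    by rewrite e (clP l k).1 // et'E // /=; ring.
  by rewrite (clP l k).1 // /=; ring.
by rewrite big_split /= -!mulr_sumr -big_mkcond big_pred1_eq; ring.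
Qed.

End Moments.

(** * Root eigenvectors of distance-regular graphs *)

Section RootVector.
Variables (R : realType) (G : sgraph) (r : G).

Definition root_vec (t : R) (x : G) : R := @root_proj R G r t 0 (enum_rank x).

Lemma root_vec_eigen t x : \sum_(z | adj x z) root_vec t z = t * root_vec t x.
Proof.
have /matrixP/(_ 0 (enum_rank x)) := @root_proj_eigen R G r t.
rewrite mxE [RHS]mxE => <-; rewrite (reindex enum_rank) /=; last first.
  by apply: onW_bij; apply: enum_rank_bij.
rewrite big_mkcond; apply: eq_bigr => z _; rewrite [adjmx R G _ _]mxE !enum_rankK adj_sym.
by case: (adj _ _); rewrite ?mulr1 ?mulr0.
Qed.

Lemma root_vec_root t : root_vec t r = @omega R G r t.
Proof. exact: root_proj_norm. Qed.

Lemma root_vec_eq0 t x : @omega R G r t = 0 -> root_vec t x = 0.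
Proof. by move/eqP; rewrite omega_eq0 /root_vec => /eqP ->; rewrite mxE. Qed.

Lemma dr_regular : distance_regular G -> forall x y : G, valency x = valency y.
Proof.
move=> [Gc [b [c H]]]; suff E (x : G) : valency x = b 0%N by move=> x y; rewrite !E.
have [+ _] := H x x; rewrite gdistxx // => <-; apply: eq_card => z.
by rewrite !inE; case: (boolP (adj x z)) => //= xz; rewrite gdist_adj.
Qed.

(** How many neighbours of a vertex lie at a given distance from [r] depends only on the
    distance of the vertex from [r]. *)
Lemma dr_sum_nbr (f : G -> R) : distance_regular G ->
  (forall x y, gdist r x = gdist r y -> f x = f y) ->
  forall x y, gdist r x = gdist r y ->
    \sum_(z | adj x z) f z = \sum_(z | adj y z) f z.
Proof.
move=> Gdr Hf x y xy; have [Gc [b [c H]]] := Gdr.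
pose N (e : nat) (x : G) := #|[pred z | adj x z & gdist r z == e]|.
have NE e : N e x = N e y.
  have [Hxb Hxc] := H r x; have [Hyb Hyc] := H r y.
  have near (u z : G) : adj u z ->
      (gdist r z <= (gdist r u).+1 /\ gdist r u <= (gdist r z).+1)%N.
    move=> uz; have := gdist_triangle Gc u r z; have := gdist_triangle Gc z r u.
    by rewrite (gdistC Gc z u) (gdist_adj Gc uz); lia.
  have Nup (u : G) : N (gdist r u).+1 u = b (gdist r u) by have [<- _] := H r u.
  have Ndn (u : G) k : gdist r u = k.+1 -> N k u = c (gdist r u).
    by move=> e'; have [_ <-] := H r u; apply: eq_card => z; rewrite !inE e' eqSS.
  have Nout (u : G) k : (k.+1 < gdist r u)%N || ((gdist r u).+1 < k)%N -> N k u = 0%N.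
    move=> h; apply: eq_card0 => z; rewrite !inE; apply/negP => /andP[uz /eqP zk].
    by have := near u z uz; lia.
  have Nsum (u : G) : valency u = (N (gdist r u).+1 u + N (gdist r u) u +
      (if gdist r u is k.+1 then N k u else 0))%N.
    rewrite /valency -sum1_card (bigID (fun z => gdist r z == (gdist r u).+1)) /=.
    rewrite -addnA; congr (_ + _)%N; first by rewrite /N -sum1_card; apply: eq_bigl => z; rewrite !inE.
    rewrite (bigID (fun z => gdist r z == gdist r u)) /=; congr (_ + _)%N.
      rewrite /N -sum1_card; apply: eq_bigl => z; rewrite !inE -andbA; congr (_ && _).
      by apply/andP/idP => [[]//|/eqP ->]; split=> //; rewrite neq_ltn ltnS leqnn.
    case E : (gdist r u) => [|k]; last first.
      rewrite /N -sum1_card; apply: eq_bigl => z; rewrite !inE -!andbA.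
      case: (boolP (adj u z)) => //= uz; have := near u z uz; rewrite E; lia.
    apply: big_pred0 => z; rewrite inE; case: (boolP (adj u z)) => //= uz.
    by have := near u z uz; rewrite E; lia.
  have [e1|ne1] := eqVneq e (gdist r x).+1; first by rewrite e1 Nup xy Nup.
  have [e2|ne2] := eqVneq e.+1 (gdist r x).
    by rewrite (Ndn x) ?(Ndn y) ?xy // -?xy.
  have [e3|ne3] := eqVneq e (gdist r x); last by rewrite !Nout // -?xy; lia.
  have vx := Nsum x; have vy := Nsum y; rewrite e3.
  rewrite !Nup -xy in vx vy; rewrite (dr_regular Gdr x y) in vx.
  case E : (gdist r x) vx vy => [|k]; first by lia.
  by rewrite (Ndn x k E) (Ndn y k) -?xy // E; lia.
pose h e := if [pick z | gdist r z == e] is Some z then f z else 0.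
have S (u : G) : \sum_(z | adj u z) f z = \sum_(e < #|G|.+1) h e * (N e u)%:R.
  have ltd z : (gdist r z < #|G|.+1)%N.
    by rewrite ltnS -[X in (_ <= X)%N](size_iota 0) find_size.
  rewrite (partition_big (fun z => inord (gdist r z) : 'I_#|G|.+1) xpredT) //=.
  apply: eq_bigr => e _; rewrite mulr_natr -sumr_const.
  apply: eq_big => z; first by rewrite !inE -val_eqE /= inordK.
  case/andP => _ /eqP <-; rewrite /h inordK //.
  by case: pickP => [z' /eqP|/(_ z)]; [move/Hf|rewrite eqxx].
by rewrite !S; apply: eq_bigr => e _; rewrite NE.
Qed.

(** The indicator of the root depends only on the distance from the root, adjacency preserves
    this property by [dr_sum_nbr], and [spectral_filter] extracts a single eigencomponent. *)
Lemma root_vec_distance : distance_regular G -> forall t x y,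
  gdist r x = gdist r y -> root_vec t x = root_vec t y.
Proof.
move=> Gdr t x y; have [Gc _] := Gdr.
have [rs rsu [rsT rsE]] := root_proj_decomp R r.
have [trs|ntrs] := boolP (t \in rs); last first.
  have w0 : @omega R G r t = 0.
    apply/eqP; rewrite omega_eq0; apply: contraNT ntrs => nz; exact: rsT.
  by move=> _; rewrite !root_vec_eq0.
pose vv (c : 'I_(size rs) -> R) z := \sum_j c j * root_vec rs`_j z.
pose S c := forall x y, gdist r x = gdist r y -> vv c x = vv c y.
have S_lin a c1 c2 : S c1 -> S c2 -> S (fun j => a * c1 j + c2 j).
  move=> S1 S2 x' y' xy.
  have E z : vv (fun j => a * c1 j + c2 j) z = a * vv c1 z + vv c2 z.
    by rewrite /vv mulr_sumr -big_split; apply: eq_bigr => j _ /=; ring.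
  by rewrite !E (S1 x' y') // (S2 x' y').
have Smu c : S c -> S (fun j => rs`_j * c j).
  move=> Sc x' y' xy.
  have E z : vv (fun j => rs`_j * c j) z = \sum_(u | adj z u) vv c u.
    rewrite /vv exchange_big; apply: eq_bigr => j _ /=.
    by rewrite -mulr_sumr root_vec_eigen; ring.
  rewrite !E; exact: dr_sum_nbr.
have S1 : S (fun _ => 1).
  have E z : vv (fun _ => 1) z = (z == r)%:R.
    have := congr1 (fun u : 'rV_#|G| => u 0 (enum_rank z)) rsE.
    rewrite summxE mxE eqxx /= (inj_eq enum_rank_inj) => <-.
    by rewrite (big_nth 0) big_mkord; apply: eq_bigr => j _; rewrite mul1r.
  by move=> x' y' xy; rewrite !E ![_ == r]eq_sym -!(gdist_eq0 Gc) xy.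
have := spectral_filter S_lin Smu (fun l => (l == t)%:R) S1.
have E z : vv (fun j => (rs`_j == t)%:R * 1) z = root_vec t z.
  have lt : (index t rs < size rs)%N by rewrite index_mem.
  rewrite /vv (bigD1 (Ordinal lt)) //= nth_index // eqxx !mul1r big1 ?addr0 // => j ji.
  rewrite (_ : (rs`_j == t) = false) ?mul0r //; apply: contraNF ji => /eqP e.
  by rewrite -val_eqE /= -e index_uniq.
by move=> h xy; rewrite -!E; apply: h.
Qed.

Lemma root_vec_nbr : distance_regular G -> forall t x, adj r x ->
  (valency r)%:R * root_vec t x = t * @omega R G r t.
Proof.
move=> Gdr t x rx; have [Gc _] := Gdr; rewrite -root_vec_root -root_vec_eigen.
rewrite (eq_bigr (fun=> root_vec t x)) => [|z rz]; last first.
  by apply: root_vec_distance => //; rewrite !gdist_adj.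
by rewrite sumr_const mulr_natl.
Qed.

End RootVector.

Section ThetaFamily.
Variables (R : realType) (s : nat) (F : 'I_s -> sgraph) (r : forall i, F i).

(** One list of eigenvalues serves all factors: an eigenvalue outside the root spectrum of
    [F i] merely contributes the zero vector there. *)
Lemma theta_family : exists n, exists th : 'I_n -> R, injective th /\
  forall i, (forall t, @omega R (F i) (r i) t != 0 -> exists j, th j = t) /\
    forall x, \sum_j root_vec (r i) (th j) x = (x == r i)%:R.
Proof.
have H i : {rs : seq R | uniq rs /\
    ((forall t, Theta R (r i) t -> t \in rs) /\
     \sum_(t <- rs) @root_proj R (F i) (r i) t = delta_mx 0 (enum_rank (r i)))}.
  by apply: cid; have [rs rsu h] := root_proj_decomp R (r i); exists rs.
pose L := undup (flatten [seq sval (H i) | i : 'I_s]).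
have uL : uniq L := undup_uniq _.
have sub i : {subset sval (H i) <= L}.
  move=> t ti; rewrite mem_undup; apply/flattenP; exists (sval (H i)) => //.
  by apply: map_f; rewrite mem_enum.
exists (size L), (fun j => L`_j); split.
  by move=> j k /eqP; rewrite nth_uniq // => /eqP /val_inj.
move=> i; have [ui [Ti Ei]] := svalP (H i); split=> [t tn|x].
  have tL : t \in L by apply: sub; apply: Ti; rewrite omega_eq0 in tn.
  by exists (Ordinal (etrans (index_mem t L) tL)); rewrite /= nth_index.
have := congr1 (fun u : 'rV_#|F i| => u 0 (enum_rank x)) Ei.
rewrite summxE mxE eqxx /= (inj_eq enum_rank_inj) => <-.
rewrite -(big_mkord xpredT (fun j => root_vec (r i) L`_j x)) -(big_nth 0 xpredT (fun t => root_vec (r i) t x)).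
rewrite (bigID (mem (sval (H i)))) /= [X in _ + X]big1 ?addr0; last first.
  move=> t tn; apply: root_vec_eq0; apply/eqP; rewrite omega_eq0; apply: contraNT tn => nz.
  exact: Ti.
rewrite -big_filter; apply: perm_big; apply: uniq_perm => //; first exact: filter_uniq.
by move=> t; rewrite mem_filter; apply/andP/idP => [[]//|ti]; split; [exact: ti | exact: (sub i _ ti)].
Qed.

Variables (n : nat) (th : 'I_n -> R).
Hypothesis th_inj : injective th.
Hypothesis th_cover : forall i t, @omega R (F i) (r i) t != 0 -> exists j, th j = t.

Lemma Phi_exp_moment i : @Phi R (F i) (r i) =
  exp_moment th (fun i j => @omega R (F i) (r i) (th j)) 0 i.
Proof.
apply/funext => z; rewrite /Phi (fsbig_fwiden [seq th j | j : 'I_n]).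
- by rewrite big_image; apply: eq_bigr => j _; rewrite expr0 mulr1.
- move=> t Tt /=; have [|j <-] := @th_cover i t; first by rewrite omega_eq0.
  by apply: map_f; rewrite mem_enum.
- by rewrite map_inj_uniq // enum_uniq.
move=> t [_ nT] /=; apply/eqP; rewrite mulf_eq0 omega_eq0; apply/orP; left.
by apply/negPn/negP => h; apply: nT.
Qed.

Lemma eta_boundary_fun i : Defs.eta R (r i) =
  boundary_fun th (fun i j => @omega R (F i) (r i) (th j)) (fun i => (valency (r i))%:R) i.
Proof.
apply/funext => z; rewrite /Defs.eta /boundary_fun; congr (_ * (_ / _)).
  by rewrite derive1E Phi_exp_moment; apply: derive_val; apply: is_derive_exp_moment.
by rewrite Phi_exp_moment.
Qed.

End ThetaFamily.

(** * The local algebra and functions on the graph *)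

Section RootedSpace.
Variables (R : realType) (G : sgraph) (a : G).
Local Notation space := 'cV[R]_#|vdel a|.
Local Notation P := (P_space R a).

Definition restr (f : G -> R) : space := \col_i f (val (enum_val i)).

Lemma restr_lin b (f g : G -> R) :
  restr (fun x => b * f x + g x) = b *: restr f + restr g.
Proof. by apply/matrixP => i j; rewrite !mxE. Qed.

Lemma eq_restr (f g : G -> R) :
  (forall x, x != a -> f x = g x) -> restr f = restr g.
Proof. by move=> fg; apply/matrixP => i j; rewrite !mxE fg //; exact: (valP (enum_val i)). Qed.

Lemma restr_inj (f g : G -> R) :
  restr f = restr g -> forall x, x != a -> f x = g x.
Proof.
move=> fg x xa; have := congr1 (fun v : space => v (enum_rank (exist _ x xa : vdel a)) 0) fg.
by rewrite !mxE enum_rankK.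
Qed.

(** When [f] vanishes at the root, deleting the root loses nothing in the neighbour sums. *)
Lemma adjmx_restr (f : G -> R) : f a = 0 ->
  adjmx R (vdel a) *m restr f = restr (fun x => \sum_(y | adj x y) f y).
Proof.
move=> fa; apply/matrixP => i j; rewrite !mxE.
rewrite (bigID (pred1 a)) /= [X in _ = X + _]big1 ?add0r => [|y /andP[_ /eqP -> //]].
rewrite [RHS](reindex_omap (val : vdel a -> G) insub) /=; last first.
  by move=> y /andP[_ ya]; rewrite insubT.
rewrite (reindex (@enum_rank (vdel a))) /=; last by apply: onW_bij; apply: enum_rank_bij.
rewrite [RHS]big_mkcond /=; apply: eq_bigr => z _.
rewrite !mxE !enum_rankK valK eqxx andbT (valP z) andbT.
rewrite (_ : adj (enum_val i) z = adj (sval (enum_val i)) (sval z)) //.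
by case: (adj (sval _) _); rewrite ?mul1r ?mul0r.
Qed.

Lemma nbr_mx_restr (f : G -> R) :
  nbr_mx R a *m restr f = restr (fun x => (adj a x)%:R * f x).
Proof.
apply/matrixP => i j; rewrite mul_diag_mx !mxE.
by [].
Qed.

Lemma P_space_memP v : v \in P <->
  exists2 M, gen_alg [set adjmx R (vdel a); nbr_mx R a]%classic M & v = M *m const_mx 1.
Proof.
split=> [/memv_imgP[M /mem_local_alg gM ->]|[M gM ->]].
  by exists M; rewrite ?lfunE.
apply/memv_imgP; exists M; first exact/mem_local_alg.
by rewrite lfunE.
Qed.

Lemma P_space_one : restr (fun=> 1) \in P.
Proof.
apply/P_space_memP; exists 1%:M; first exact: gen_alg1.
by rewrite mul1mx; apply/matrixP => i j; rewrite !mxE.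
Qed.

Lemma P_space_adj v : v \in P -> adjmx R (vdel a) *m v \in P.
Proof.
move/P_space_memP => [M gM ->]; apply/P_space_memP; exists (adjmx R (vdel a) *m M).
  by apply: gen_algM => //; apply: gen_alg_in; left.
by rewrite mulmxA.
Qed.

Lemma P_space_nbr v : v \in P -> nbr_mx R a *m v \in P.
Proof.
move/P_space_memP => [M gM ->]; apply/P_space_memP; exists (nbr_mx R a *m M).
  by apply: gen_algM => //; apply: gen_alg_in; right.
by rewrite mulmxA.
Qed.

Lemma P_space_min (U : {vspace space}) :
  restr (fun=> 1) \in U ->
  (forall v, v \in U -> adjmx R (vdel a) *m v \in U) ->
  (forall v, v \in U -> nbr_mx R a *m v \in U) -> (P <= U)%VS.
Proof.
move=> U1 UA UE; apply/subvP => v /P_space_memP[M gM ->].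
have -> : const_mx 1 = restr (fun=> 1) by apply/matrixP => i j; rewrite !mxE.
elim: {v}M / gM (restr _) U1 => [M [->|->]||M N _ IHM _ IHN|c M _ IH|M N _ IHM _ IHN] u Uu.
- exact: UA.
- exact: UE.
- by rewrite mul1mx.
- by rewrite mulmxDl memvD ?IHM ?IHN.
- by rewrite -scalemxAl memvZ ?IH.
- by rewrite -mulmxA; apply: IHM; apply: IHN.
Qed.

End RootedSpace.

(** * Dimension of a span as a matrix rank *)

Section SpanRank.
Variables (K : fieldType) (V : vectType K) (p : nat) (X : p.-tuple V).

Definition lin_comb (u : 'rV[K]_p) : V := \sum_(k < p) u 0 k *: X`_k.

Lemma lin_comb_mul q (c : 'rV[K]_q) (B : 'M[K]_(q, p)) :
  lin_comb (c *m B) = \sum_(i < q) c 0 i *: lin_comb (row i B).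
Proof.
rewrite /lin_comb; under eq_bigr do rewrite mxE scaler_suml.
rewrite exchange_big; apply: eq_bigr => i _; rewrite scaler_sumr.
by apply: eq_bigr => k _; rewrite scalerA mxE.
Qed.

Lemma lin_comb_span_sub q1 q2 (A : 'M[K]_(q1, p)) (B : 'M[K]_(q2, p)) :
  (A <= B)%MS ->
  (<<[seq lin_comb (row i A) | i : 'I_q1]>> <= <<[seq lin_comb (row i B) | i : 'I_q2]>>)%VS.
Proof.
move=> AB; apply/span_subvP => _ /mapP[i _ ->].
have /submxP[c ->] : (row i A <= B)%MS by apply: submx_trans (row_sub i A) AB.
rewrite lin_comb_mul; apply: memv_suml => j _; apply/memvZ/memv_span.
by apply: map_f; rewrite mem_enum.
Qed.

(** Column operations do not change either side, so the columns may be replaced by a row basis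
    of the transpose, whose combinations are free. *)
Lemma dim_span_comb q (M : 'M[K]_(p, q)) : free X ->
  \dim <<[seq \sum_(k < p) M k j *: X`_k | j : 'I_q]>> = \rank M.
Proof.
move=> Xf; rewrite -mxrank_tr; set B := row_base M^T.
have -> : [seq \sum_(k < p) M k j *: X`_k | j : 'I_q] = [seq lin_comb (row j M^T) | j : 'I_q].
  by apply: eq_map => j; apply: eq_bigr => k _; rewrite !mxE.
have -> : <<[seq lin_comb (row j M^T) | j : 'I_q]>>%VS =
          <<[seq lin_comb (row j B) | j : 'I_(\rank M^T)]>>%VS.
  by apply: subv_anti; rewrite !lin_comb_span_sub // eq_row_base submx_refl.
pose Y := [tuple lin_comb (row i B) | i < \rank M^T].
have Yf : free Y.
  apply/freeP => c; under eq_bigr do rewrite -tnth_nth tnth_mktuple.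
  move=> c0 i; have : lin_comb ((\row_i c i) *m B) = 0.
    by rewrite lin_comb_mul -[RHS]c0; apply: eq_bigr => j _; rewrite mxE.
  move/freeP: Xf => Xf /Xf h.
  have : (\row_i c i) *m B = 0 by apply/rowP => k; rewrite h mxE.
  move/(canRL (mulmxKp (row_base_free _))); rewrite mul0mx => /rowP/(_ i).
  by rewrite !mxE.
by move: Yf; rewrite /free => /eqP; rewrite size_tuple.
Qed.

End SpanRank.

(** * Joint eigenvector expansions in the product *)

(** Maximum principle: at a maximum of an eigenfunction for the valency, all neighbours
    share the maximal value. *)
Lemma harmonic_const (R : realType) (G : sgraph) (f : G -> R) :
  graph_connected G -> (forall x, \sum_(y | adj x y) f y = (valency x)%:R * f x) ->
  forall x y, f x = f y.
Proof.
move=> Gc fA x; have [x0 _ mx] := @arg_maxP _ _ _ x xpredT f isT.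
have step y z : f y = f x0 -> adj y z -> f z = f x0.
  move=> yx yz; have : \sum_(z | adj y z) (f x0 - f z) = 0.
    by rewrite sumrB fA sumr_const mulr_natl yx subrr.
  move/eqP; rewrite psumr_eq0 => [/allP/(_ z (mem_index_enum z))|u _]; last first.
    by rewrite subr_ge0; exact: (mx u isT).
  by rewrite yz /= subr_eq0 => /eqP.
suff all_eq y : f y = f x0 by move=> y; rewrite !all_eq.
have H p x' : f x' = f x0 -> path adj x' p -> f (last x' p) = f x0.
  by elim: p x' => [|z p IH] x' //= e /andP[xz]; apply: IH; apply: step xz.
by have /connectP[p px ->] := Gc x0 y; apply: H.
Qed.

Section ProductSpectrum.
Variables (R : realType) (s : nat) (F : 'I_s -> sgraph) (m : 'I_s -> nat).
Variables (r : forall i, F i).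
Hypothesis F_nontrivial : forall i, nontrivial (F i).
Hypothesis F_dr : forall i, distance_regular (F i).
Variables (n : nat) (th : 'I_n -> R).
Hypothesis th_sum : forall i x, \sum_j root_vec (r i) (th j) x = (x == r i)%:R.

Local Notation copy := (copy m).
Local Notation FK := (fun k : copy => F (tag k)).
Local Notation T := {dffun forall k : copy, F (tag k)}.
Local Notation a := (prod_root m r : T).
Local Notation G := (prod_graph F m).

Definition copy_weight (k : copy) j := @omega R _ (r (tag k)) (th j).
Definition copy_valency (k : copy) : R := (valency (r (tag k)))%:R.

Variables (t : nat) (cl : copy -> 'I_t).
Local Notation boundary_fun := (boundary_fun th copy_weight copy_valency).
Local Notation boundary_deriv := (boundary_deriv th copy_weight copy_valency).
Local Notation total_moment := (total_moment th copy_weight).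
Hypothesis clP : forall k l, cl k = cl l <-> boundary_fun k = boundary_fun l.

Local Notation J := {ffun copy -> 'I_n}.
Local Notation joint_weight := (joint_weight copy_weight).
Local Notation eig_sum := (eig_sum th).
Local Notation class_sum := (class_sum th cl).
Local Notation class_valency := (class_valency copy_valency cl).
Implicit Types (x y : T) (k l : copy) (tau : J) (c : J -> R).

Let F_conn i : graph_connected (F i). Proof. by have [] := F_dr i. Qed.

Lemma rootE k : a k = r (tag k). Proof. by rewrite ffunE. Qed.

Lemma copy_weight_ge0 k j : 0 <= copy_weight k j. Proof. exact: omega_ge0. Qed.

Lemma copy_weight_sum1 k : \sum_j copy_weight k j = 1.
Proof.
transitivity (\sum_j root_vec (r (tag k)) (th j) (r (tag k))).
  by apply: eq_bigr => j _; rewrite root_vec_root.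
by rewrite th_sum eqxx.
Qed.

Lemma copy_weight_mean0 k : \sum_j copy_weight k j * th j = 0.
Proof.
transitivity (\sum_j \sum_(z | adj (r (tag k)) z) root_vec (r (tag k)) (th j) z).
  by apply: eq_bigr => j _; rewrite root_vec_eigen root_vec_root mulrC.
rewrite exchange_big big1 //= => z rz; rewrite th_sum.
by case: eqP rz => // ->; rewrite adj_irr.
Qed.

Lemma copy_valency_gt0 k : 0 < copy_valency k.
Proof.
rewrite /copy_valency ltr0n; have /card_gt1P[u [v [_ _ uv]]] := F_nontrivial (tag k).
have [y ry] : exists y : F (tag k), r (tag k) != y.
  by have [e|] := eqVneq (r (tag k)) u; [exists v; rewrite e | exists u].
have [z rz _] := gdist_step (@F_conn _) ry.
by apply/card_gt0P; exists z.
Qed.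

(** These joint eigenvectors are not normalized: their sum is the indicator of the root, as
    [expand1] shows. *)
Definition tensor_vec tau x := \prod_k root_vec (r (tag k)) (th (tau k)) (x k).
Definition expand c x := \sum_tau c tau * tensor_vec tau x.

Lemma expand_lin b c1 c2 x :
  expand (fun tau => b * c1 tau + c2 tau) x = b * expand c1 x + expand c2 x.
Proof. by rewrite /expand mulr_sumr -big_split; apply: eq_bigr => tau _ /=; ring. Qed.

Lemma expand1 x : expand (fun=> 1) x = (x == a)%:R.
Proof.
rewrite /expand (eq_bigr (fun tau => tensor_vec tau x)) => [|tau _]; last by rewrite mul1r.
rewrite -(bigA_distr_bigA (fun k j => root_vec (r (tag k)) (th j) (x k))) /=.
rewrite (eq_bigr (fun k => (x k == r (tag k))%:R)) => [|k _]; last exact: th_sum.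
have [->|ne] := eqVneq x a; first by rewrite big1 // => k _; rewrite rootE eqxx.
have [k xk|h] := pickP (fun k => x k != r (tag k)).
  by rewrite (bigD1 k) //= (negPf xk) mul0r.
by case/eqP: ne; apply/ffunP => k; have := h k; rewrite rootE => /negbFE/eqP.
Qed.

(** The adjacency operator of a single copy acts on [tensor_vec tau] as a scalar. *)
Lemma expand_coord k c x :
  \sum_(u | adj (x k) u) expand c (upd x u) = expand (fun tau => th (tau k) * c tau) x.
Proof.
rewrite /expand exchange_big; apply: eq_bigr => tau _ /=.
rewrite -mulr_sumr [th _ * _]mulrC -mulrA; congr (_ * _).
rewrite /tensor_vec [in RHS](bigD1 k) //= mulrA -root_vec_eigen mulr_suml.
apply: eq_bigr => u _; rewrite (bigD1 k) //= upd_in; congr (_ * _).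
by apply: eq_bigr => l lk; rewrite upd_out.
Qed.

Lemma sum_cart_nbr (f : T -> R) x :
  \sum_(y : T | @adj G x y) f y = \sum_k \sum_(u | adj (x k) u) f (upd x u).
Proof.
transitivity (\sum_(y : T) \sum_(k | adj (x k) (y k) && (y == upd x (y k))) f y).
  rewrite big_mkcond; apply: eq_bigr => y _.
  case: cartP => [[k [xy e]]|h].
    rewrite (big_pred1 k) // => l; apply/andP/eqP => [[xyl /eqP e']|->]; last first.
      by split=> //; apply/eqP.
    apply: contraTeq xyl => lk; rewrite e upd_out ?adj_irr //.
  rewrite big_pred0 // => k; apply/negP => /andP[xy /eqP e]; apply: h.
  by exists k.
rewrite (exchange_big_dep xpredT) //=; apply: eq_bigr => k _.
rewrite (reindex_onto (fun u : F (tag k) => upd x u) (fun y => y k)) /=; last first.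
  by move=> y /andP[_ /eqP <-].
by apply: eq_bigl => u; rewrite upd_in !eqxx !andbT.
Qed.

Lemma expand_adj c x :
  \sum_(y : T | @adj G x y) expand c y = expand (fun tau => eig_sum tau * c tau) x.
Proof.
rewrite sum_cart_nbr (eq_bigr _ (fun k _ => expand_coord k c x)) /expand exchange_big.
by apply: eq_bigr => tau _; rewrite -!mulr_suml.
Qed.

Lemma expand_root c : expand c a = \sum_tau joint_weight tau * c tau.
Proof.
apply: eq_bigr => tau _; rewrite mulrC; congr (_ * _); apply: eq_bigr => k _.
by rewrite rootE root_vec_root.
Qed.

Lemma tensor_vec_upd_root tau k (u : F (tag k)) :
  tensor_vec tau (upd a u) =
  root_vec (r (tag k)) (th (tau k)) u * \prod_(l | l != k) copy_weight l (tau l).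
Proof.
rewrite /tensor_vec (bigD1 k) //; congr (_ * _); first by rewrite upd_in.
apply: eq_bigr => l lk; rewrite upd_out //.
by rewrite /copy_weight -root_vec_root rootE.
Qed.

Lemma class_valency_neq0 k : class_valency (cl k) != 0.
Proof.
rewrite gt_eqF // /class_valency (bigD1 k) //= ltr_pwDl ?copy_valency_gt0 // sumr_ge0 // => l _.
Qed.

(** In a distance-regular factor an eigencomponent of the root takes on the neighbours of the
    root its value at the root times the eigenvalue over the valency; [class_moment] then
    makes the outcome depend on [k] only through its class. *)
Lemma expand_nbr (f : ('I_t -> R) -> R) k u : adj (r (tag k)) u ->
  expand (fun tau => f (class_sum tau)) (upd a u) =
  (\sum_tau joint_weight tau * class_sum tau (cl k) * f (class_sum tau)) / class_valency (cl k).
Proof.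
move=> ru; apply: (mulIf (class_valency_neq0 k)); rewrite divfK ?class_valency_neq0 //.
have d0 : copy_valency k != 0 by rewrite gt_eqF ?copy_valency_gt0.
apply: (mulfI d0); rewrite -(class_moment copy_valency_gt0 copy_weight_ge0 copy_weight_sum1 clP f k).
rewrite mulrA mulrC; congr (_ * _).
rewrite /expand mulr_sumr; apply: eq_bigr => tau _.
rewrite tensor_vec_upd_root /joint_weight [in RHS](bigD1 k) //=.
have := root_vec_nbr (F_dr (tag k)) (th (tau k)) ru; rewrite -/(copy_valency k) -/(copy_weight k (tau k)) => e.
set p := \prod_(i | i != k) copy_weight i (tau i).
transitivity (f (class_sum tau) * (copy_valency k * root_vec (r (tag k)) (th (tau k)) u) * p); first by ring.
by rewrite e; ring.
Qed.

Lemma adj_rootP x : reflect (exists k u, adj (r (tag k)) u /\ x = upd a u) (@adj G a x).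
Proof.
apply: (iffP (@cartP _ FK a x)) => [[k [ax e]]|[k [u [ru ->]]]].
  by exists k, (x k); rewrite rootE in ax.
by exists k; rewrite upd_in rootE.
Qed.

Lemma expand_class_sum_nbr g k u : adj (r (tag k)) u ->
  expand (fun tau => class_sum tau g) (upd a u) = (cl k == g)%:R.
Proof.
move=> ru.
transitivity (\sum_(l | cl l == g) \sum_(v | adj (upd a u l) v) (upd (upd a u) v == a)%:R : R).
  rewrite (eq_bigr (fun l => expand (fun tau => th (tau l) * 1) (upd a u))); last first.
    by move=> l _; rewrite -expand_coord; apply: eq_bigr => v _; rewrite expand1.
  rewrite /expand exchange_big; apply: eq_bigr => tau _.
  by rewrite /class_sum mulr_suml; apply: eq_bigr => l _; rewrite mulr1.
have ne : u != r (tag k) by apply/eqP => e; rewrite e adj_irr in ru.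
have E l : \sum_(v | adj (upd a u l) v) (upd (upd a u) v == a)%:R = (l == k)%:R :> R.
  have [->|lk] := eqVneq l k.
    rewrite upd_in (bigD1 (r (tag k))) /=; last by rewrite adj_sym.
    rewrite upd_upd (_ : upd a (r (tag k)) == a); last first.
      by apply/eqP; rewrite -[in RHS](upd_id a k) rootE.
    rewrite big1 ?addr0 // => v /andP[_ vr]; rewrite upd_upd.
    case: eqP => // /(congr1 (fun z : T => z k)); rewrite upd_in rootE => e.
    by rewrite e eqxx in vr.
  rewrite big1 // => v _; case: eqP => // /(congr1 (fun z : T => z k)).
  by rewrite upd_out 1?eq_sym // upd_in rootE => e; rewrite e eqxx in ne.
rewrite (eq_bigr _ (fun l _ => E l)) big_mkcond (bigD1 k) //= eqxx big1 ?addr0.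
  by case: eqP.
by move=> l /negPf ->; case: ifP.
Qed.

Lemma expand_class_sum_far g x : ~~ @adj G a x -> expand (fun tau => class_sum tau g) x = 0.
Proof.
move=> ax.
transitivity (\sum_(l | cl l == g) \sum_(v | adj (x l) v) (upd x v == a)%:R : R).
  rewrite (eq_bigr (fun l => expand (fun tau => th (tau l) * 1) x)); last first.
    by move=> l _; rewrite -expand_coord; apply: eq_bigr => v _; rewrite expand1.
  rewrite /expand exchange_big; apply: eq_bigr => tau _.
  by rewrite /class_sum mulr_suml; apply: eq_bigr => l _; rewrite mulr1.
rewrite big1 // => l _; rewrite big1 // => v xv; case: eqP => // e.
case/negP: ax; rewrite adj_sym; apply/cartP; exists l.
by rewrite -e upd_in.
Qed.

(** The coefficients of a vanishing expansion form a space stable under multiplication by each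
    class sum, since that multiplication applies the adjacency operators of the class. *)
Lemma expand_eq0_joint c (f : ('I_t -> R) -> R) :
  (forall x, expand c x = 0) -> forall x, expand (fun tau => f (class_sum tau) * c tau) x = 0.
Proof.
pose S c := forall x, expand c x = 0.
have S_lin b c1 c2 : S c1 -> S c2 -> S (fun j => b * c1 j + c2 j).
  by move=> S1 S2 x; rewrite expand_lin S1 S2 mulr0 addr0.
apply: (joint_spectral_filter (mu := fun g tau => class_sum tau g) S_lin) => g c1 S1 x.
transitivity (\sum_(l | cl l == g) \sum_(v | adj (x l) v) expand c1 (upd x v)).
  rewrite (eq_bigr _ (fun l _ => expand_coord l c1 x)) /expand exchange_big.
  by apply: eq_bigr => tau _; rewrite -!mulr_suml.
by rewrite big1 // => l _; rewrite big1.
Qed.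

Definition deg : R := \sum_k copy_valency k.

Lemma sum_cart_nbr1 x : \sum_(y : T | @adj G x y) 1 = deg.
Proof.
rewrite (sum_cart_nbr (fun=> 1)); apply: eq_bigr => k _.
by rewrite sumr_const /copy_valency (dr_regular (F_dr _) _ (x k)).
Qed.

(** In a connected graph the functions with the valency as eigenvalue are constant. The
    constant is not zero because all other components of the indicator of the root have
    coordinate sum 0, whereas that indicator has sum 1. *)
Lemma expand_const : exists2 b, b != 0 & forall x,
  expand (fun tau => (eig_sum tau == deg)%:R) x = b.
Proof.
pose c tau : R := (eig_sum tau == deg)%:R.
have cst x : expand c x = expand c a.
  apply: (@harmonic_const R G (expand c)); first exact: (cart_connected (fun k => @F_conn (tag k))).
  move=> {}x; rewrite (expand_adj c) (_ : (valency x)%:R = deg); last first.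
    by rewrite -(sum_cart_nbr1 x) sumr_const.
  rewrite /expand mulr_sumr; apply: eq_bigr => tau _; rewrite /c.
  by case: eqP => [->|_] /=; ring.
exists (expand c a) => //; apply/eqP => c0.
(* Summing over all vertices is adjoint to the constant function, an eigenvector for deg. *)
have L tau : eig_sum tau * (\sum_x tensor_vec tau x) = deg * (\sum_x tensor_vec tau x).
  have E x : eig_sum tau * tensor_vec tau x = \sum_(y : T | @adj G x y) tensor_vec tau y.
    pose e tau' : R := (tau' == tau)%:R.
    have ee y (b : J -> R) : expand (fun tau => b tau * e tau) y = b tau * tensor_vec tau y.
      rewrite /expand (bigD1 tau) //= /e eqxx mulr1 big1 ?addr0 // => i /negPf ->.
      by rewrite mulr0 mul0r.
    rewrite -ee -expand_adj; apply: eq_bigr => y _.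
    by have := ee y (fun=> 1); rewrite mul1r => <-; apply: eq_bigr => i _; rewrite mul1r.
  rewrite [LHS]mulr_sumr (eq_bigr _ (fun x _ => E x)) (exchange_big_dep xpredT) //= mulr_sumr.
  apply: eq_bigr => y _; rewrite -(sum_cart_nbr1 y) mulr_suml.
  by apply: eq_big => [x|x _]; rewrite ?mul1r // adj_sym.
have : \sum_x expand (fun=> 1) x = \sum_x expand c x.
  rewrite /expand exchange_big [RHS]exchange_big; apply: eq_bigr => tau _ /=.
  rewrite -!mulr_sumr /c; case: eqP => //= ne; rewrite mul1r mul0r.
  by apply/eqP; have /eqP := L tau; rewrite -subr_eq0 -mulrBl mulf_eq0 subr_eq0 => /orP[/eqP|].
rewrite [RHS]big1 => [|x _]; last by rewrite cst.
rewrite (eq_bigr _ (fun x _ => expand1 x)) (bigD1 a) //= eqxx big1 ?addr0.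
  by move/eqP; rewrite oner_eq0.
by move=> x /negPf ->.
Qed.

(** * The space P through expansions *)

Hypothesis cl_surj : forall g, exists k, cl k = g.

(** Coefficients of the vectors obtained by applying polynomials in the adjacency operator to
    the indicator of the root ([al]) and to the indicators of the neighbourhoods of the root
    in the directions of a class ([be]). *)
Definition class_form (al : R -> R) (be : 'I_t -> R -> R) tau : R :=
  al (eig_sum tau) + \sum_g be g (eig_sum tau) * class_sum tau g.

Local Notation rexp c := (restr (prod_root m r) (expand c)).
Local Notation P := (P_space R (prod_root m r)).

Lemma rexp_lin b c1 c2 :
  rexp (fun tau => b * c1 tau + c2 tau) = b *: rexp c1 + rexp c2.
Proof.
by rewrite -restr_lin; apply: eq_restr => x _; rewrite expand_lin.
Qed.

Lemma rexp1 : rexp (fun=> 1) = 0.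
Proof.
apply/matrixP => i j; rewrite !mxE expand1.
by have := valP (enum_val i); case: eqP.
Qed.

(** Subtracting a multiple of the indicator of the root does not change the restriction
    and makes the function vanish at the root, where the deletion happens. *)
Lemma adjmx_rexp c : adjmx R (vdel (prod_root m r)) *m rexp c =
  rexp (fun tau => eig_sum tau * (c tau - expand c a)).
Proof.
pose c' tau := - expand c a * 1 + c tau.
have -> : rexp c = rexp c' by rewrite rexp_lin rexp1 scaler0 add0r.
rewrite adjmx_restr; last by rewrite expand_lin expand1 eqxx mulr1 addNr.
apply: eq_restr => x _; rewrite expand_adj; apply: eq_bigr => tau _.
by rewrite /c'; ring.
Qed.

Definition nbr_coef (c : J -> R) g :=
  (\sum_tau joint_weight tau * class_sum tau g * c tau) / class_valency g.

(** An expansion whose coefficients depend only on the class sums is constant on the neighbours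
    in the directions of a class, and [class_sum] has the indicator of those as its expansion. *)
Lemma nbr_mx_rexp (f : ('I_t -> R) -> R) :
  nbr_mx R (prod_root m r) *m rexp (fun tau => f (class_sum tau)) =
  rexp (fun tau => \sum_g nbr_coef (fun tau => f (class_sum tau)) g * class_sum tau g).
Proof.
rewrite nbr_mx_restr; apply: eq_restr => x _.
have -> : expand (fun tau => \sum_g nbr_coef (fun tau => f (class_sum tau)) g * class_sum tau g) x =
    \sum_g nbr_coef (fun tau => f (class_sum tau)) g * expand (fun tau => class_sum tau g) x.
  rewrite /expand; under eq_bigr do rewrite mulr_suml.
  rewrite exchange_big; apply: eq_bigr => g _; rewrite mulr_sumr.
  by apply: eq_bigr => tau _; rewrite mulrA.
case: (boolP (@adj G a x)) => [/adj_rootP[k [u [ru ->]]]|ax]; last first.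
  by rewrite mulr0n mul0r big1 // => g _; rewrite expand_class_sum_far ?mulr0.
rewrite mulr1n mul1r (expand_nbr f ru) [RHS](bigD1 (cl k)) //= expand_class_sum_nbr // eqxx mulr1.
rewrite [X in _ = _ + X]big1 ?addr0 // => g gk; rewrite expand_class_sum_nbr //.
by rewrite eq_sym (negPf gk) mulr0.
Qed.

Let in_P c := rexp c \in P.

Let in_P_lin b c1 c2 : in_P c1 -> in_P c2 -> in_P (fun tau => b * c1 tau + c2 tau).
Proof. by move=> S1 S2; rewrite /in_P rexp_lin memvD ?memvZ. Qed.

Let in_P_one : in_P (fun=> 1). Proof. by rewrite /in_P rexp1 mem0v. Qed.

Let in_P_eig_sum : in_P eig_sum.
Proof.
have := P_space_nbr (P_space_one R (prod_root m r)); rewrite nbr_mx_restr.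
rewrite /in_P; congr (is_true (_ \in P)); apply: eq_restr => x _; rewrite mulr1.
transitivity (expand (fun tau => eig_sum tau * 1) x); last first.
  by apply: eq_bigr => tau _; rewrite mulr1.
rewrite -expand_adj (eq_bigr _ (fun y _ => expand1 y)) adj_sym.
case: (boolP (@adj G x a)) => xa.
  by rewrite (bigD1 a) //= eqxx big1 ?addr0 // => y /andP[_ /negPf ->].
by rewrite big1 // => y xy; case: eqP xy => // -> xy; rewrite xy in xa.
Qed.

(** By [adjmx_rexp] the deleted adjacency matrix multiplies by [eig_sum] up to a multiple of
    [eig_sum] itself, which is harmless by [in_P_eig_sum]. *)
Let in_P_mul_eig_sum c : in_P c -> in_P (fun tau => eig_sum tau * c tau).
Proof.
move=> Sc; have := P_space_adj Sc; rewrite adjmx_rexp => S'.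
have := in_P_lin (expand c a) in_P_eig_sum S'; congr in_P; apply/funext => tau; ring.
Qed.

Let in_P_filter g c : in_P c -> in_P (fun tau => g (eig_sum tau) * c tau).
Proof. by move=> Sc; exact: (spectral_filter (S := in_P) in_P_lin in_P_mul_eig_sum g Sc). Qed.

(** Membership in P of a combination of the indicators of the neighbourhoods attached to the
    classes. *)
Let nbr_in_P (b : 'I_t -> R) := in_P (fun tau => \sum_g b g * class_sum tau g).

Let in_P_nbr (f : ('I_t -> R) -> R) :
  in_P (fun tau => f (class_sum tau)) -> nbr_in_P (nbr_coef (fun tau => f (class_sum tau))).
Proof. by move=> Sf; rewrite /nbr_in_P /in_P -nbr_mx_rexp; apply: P_space_nbr. Qed.

Let rep g : copy := sval (cid (cl_surj g)).
Let repE g : cl (rep g) = g. Proof. by rewrite /rep; case: cid. Qed.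

Let total_moment_neq0 z : total_moment z != 0.
Proof. by apply/prodf_neq0 => k _; rewrite gt_eqF // (exp_moment0_gt0 _ copy_weight_ge0 copy_weight_sum1). Qed.

Let nbr_in_P_lin b e1 e2 : nbr_in_P e1 -> nbr_in_P e2 -> nbr_in_P (fun g => b * e1 g + e2 g).
Proof.
move=> X1 X2; have := in_P_lin b X1 X2; congr in_P; apply/funext => tau.
by rewrite mulr_sumr -big_split; apply: eq_bigr => g _ /=; ring.
Qed.

Let eig_sumE tau : eig_sum tau = \sum_g class_sum tau g. Proof. exact: eig_sum_class_sum. Qed.

(** Returning to the neighbourhood of the root from such a combination yields the second
    moment. Its part proportional to the boundary functions is the first moment, already known
    to lie in P; what remains is a multiplication by the derivative of the boundary function. *)
Let nbr_in_P_deriv b (z : R) : nbr_in_P b -> nbr_in_P (fun g => boundary_deriv (rep g) z * b g).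
Proof.
move=> Xb; pose e tau := expR (z * eig_sum tau).
pose C := \sum_l b (cl l) * copy_valency l * boundary_fun l z.
have K0 : nbr_in_P (fun g => total_moment z * boundary_fun (rep g) z).
  have := @in_P_nbr (fun y : 'I_t -> R => expR (z * \sum_g y g)).
  have Se : in_P (fun tau => expR (z * \sum_g class_sum tau g)).
    have := in_P_filter (fun q : R => expR (z * q)) in_P_one; congr in_P; apply/funext => tau.
    by rewrite mulr1 eig_sumE.
  move/(_ Se); congr nbr_in_P; apply/funext => g; rewrite /nbr_coef.
  under eq_bigr do rewrite -eig_sumE.
  rewrite -[in X in X / _](repE g) (first_moment copy_valency_gt0 copy_weight_ge0 copy_weight_sum1 clP) repE.
  by rewrite mulrAC mulfK // -(repE g) class_valency_neq0.
have K1 : nbr_in_P (fun g => total_moment z *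
    (boundary_fun (rep g) z * C + b g * boundary_deriv (rep g) z)).
  have := @in_P_nbr (fun y : 'I_t -> R => expR (z * \sum_g y g) * \sum_h b h * y h).
  have Se : in_P (fun tau => expR (z * \sum_g class_sum tau g) * \sum_h b h * class_sum tau h).
    have := in_P_filter (fun q : R => expR (z * q)) Xb; congr in_P; apply/funext => tau.
    by rewrite eig_sumE.
  move/(_ Se); congr nbr_in_P; apply/funext => g; rewrite /nbr_coef.
  under eq_bigr do rewrite -eig_sumE.
  rewrite -[in X in X / _](repE g) (second_moment copy_valency_gt0 copy_weight_ge0 copy_weight_sum1 clP) repE -/C.
  by rewrite mulrAC mulfK // -(repE g) class_valency_neq0.
have K2 := nbr_in_P_lin (- C) K0 K1.
(* The last argument is the zero combination, so only the scaling of K2 remains. *)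
have := nbr_in_P_lin (total_moment z)^-1 K2 (nbr_in_P_lin (-1) K2 K2).
congr nbr_in_P; apply/funext => g; have := total_moment_neq0 z; set p := total_moment _ => p0.
by field.
Qed.

Let nbr_in_P_one : nbr_in_P (fun=> 1).
Proof.
have := in_P_eig_sum; congr in_P; apply/funext => tau; rewrite eig_sumE.
by apply: eq_bigr => g _; rewrite mul1r.
Qed.

(** The derivatives of the boundary functions separate the classes, so a product of
    multiplications by differences of their values annihilates all classes but [g]. *)
Let in_P_csum g : in_P (fun tau => class_sum tau g).
Proof.
have H (h : 'I_t) : exists z : R, h != g ->
    boundary_deriv (rep g) z != boundary_deriv (rep h) z.
  have [->|hg] := eqVneq h g; first by exists 0.
  have [|z ez] := @boundary_deriv_sep _ _ _ _ _ _ _ cl copy_valency_gt0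
      copy_weight_ge0 copy_weight_sum1 copy_weight_mean0 clP (rep g) (rep h).
    by rewrite !repE; apply/eqP; rewrite eq_sym.
  by exists z.
have [zz Hz] := choice H.
pose p (q : 'I_t) : R := (\prod_(h <- [seq h <- enum 'I_t | h != g])
  (boundary_deriv (rep q) (zz h) - boundary_deriv (rep h) (zz h))) * 1.
have Xp : nbr_in_P p := filter_prod nbr_in_P_lin
   (mu := fun (h q : 'I_t) => boundary_deriv (rep q) (zz h))
   (fun h : 'I_t => boundary_deriv (rep h) (zz h)) [seq h <- enum 'I_t | h != g]
   (fun h b => @nbr_in_P_deriv b (zz h)) nbr_in_P_one.
pose c := p g.
have c0 : c != 0.
  rewrite /c /p mulr1 prodf_seq_neq0; apply/allP => h; rewrite mem_filter => /andP[hg _].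
  by rewrite subr_eq0 Hz.
have := nbr_in_P_lin c^-1 Xp (nbr_in_P_lin (-1) nbr_in_P_one nbr_in_P_one).
rewrite /nbr_in_P; congr in_P; apply/funext => tau.
rewrite (bigD1 g) //= -/c mulVf // big1 ?addr0 => [|q lg]; first by ring.
rewrite [p q](_ : _ = 0); first by ring.
rewrite /p mulr1; apply/eqP; rewrite prodf_seq_eq0; apply/hasP; exists q.
  by rewrite mem_filter lg mem_enum.
by rewrite subrr eqxx.
Qed.

Let in_P_class_form al be : in_P (class_form al be).
Proof.
have H (L : seq 'I_t) : in_P (fun tau => al (eig_sum tau) + \sum_(g <- L) be g (eig_sum tau) * class_sum tau g).
  elim: L => [|g L IH].
    have := in_P_filter al in_P_one; congr in_P; apply/funext => tau.
    by rewrite big_nil addr0 mulr1.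
  have := in_P_lin 1 (in_P_filter (be g) (in_P_csum g)) IH; congr in_P; apply/funext => tau.
  by rewrite big_cons; ring.
exact: H.
Qed.

(** The right-hand side contains the all-ones vector by [expand_const] and is stable under both
    generators of the algebra; conversely P contains the indicator attached to each class, by
    [in_P_csum], and all functions of the adjacency operator applied to these indicators. *)
Theorem mem_P_space v :
  v \in P <-> exists al be, v = rexp (class_form al be).
Proof.
split; last by move=> [al [be ->]]; apply: in_P_class_form.
pose W := span_set (fun v => exists al be, v = rexp (class_form al be)).
have WP u : u \in W <-> exists al be, u = rexp (class_form al be).
  apply: mem_span_set => [|b _ _ [al1 [be1 ->]] [al2 [be2 ->]]].
    exists (fun=> 0), (fun _ _ => 0); apply/matrixP => i j; rewrite !mxE /expand big1 // => tau _.
    by rewrite /class_form big1 ?add0r ?mul0r // => g _; rewrite mul0r.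
  exists (fun q : R => b * al1 q + al2 q), (fun g (q : R) => b * be1 g q + be2 g q).
  rewrite -rexp_lin; congr restr; apply/funext => x; apply: eq_bigr => tau _.
  congr (_ * _); rewrite /class_form.
  have -> : \sum_g (b * be1 g (eig_sum tau) + be2 g (eig_sum tau)) * class_sum tau g =
      b * (\sum_g be1 g (eig_sum tau) * class_sum tau g) + \sum_g be2 g (eig_sum tau) * class_sum tau g.
    by rewrite mulr_sumr -big_split; apply: eq_bigr => g _ /=; ring.
  ring.
rewrite -WP; move: v; apply/subvP; apply: P_space_min.
- apply/WP; have [b b0 Hb] := expand_const.
  exists (fun q : R => b^-1 * (q == deg)%:R), (fun _ _ => 0); apply: eq_restr => x _.
  transitivity (b^-1 * b); first by rewrite mulVf.
  rewrite -{2}(Hb x) /expand mulr_sumr; apply: eq_bigr => tau _.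
  by rewrite /class_form big1 ?addr0 ?mulrA // => g _; rewrite mul0r.
- move=> _ /WP[al [be ->]]; apply/WP; rewrite adjmx_rexp; set f0 := expand _ _.
  exists (fun q : R => q * (al q - f0)), (fun g (q : R) => q * be g q).
  congr restr; apply/funext => x; apply: eq_bigr => tau _; congr (_ * _).
  rewrite /class_form.
  have -> : \sum_g eig_sum tau * be g (eig_sum tau) * class_sum tau g =
      eig_sum tau * (\sum_g be g (eig_sum tau) * class_sum tau g).
    by rewrite mulr_sumr; apply: eq_bigr => g _; ring.
  ring.
move=> _ /WP[al [be ->]]; apply/WP.
pose f (y : 'I_t -> R) := al (\sum_g y g) + \sum_g be g (\sum_g y g) * y g.
have -> : class_form al be = fun tau => f (class_sum tau).
  by apply/funext => tau; rewrite /class_form /f -eig_sumE.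
rewrite nbr_mx_rexp; exists (fun=> 0), (fun g _ => nbr_coef (fun tau => f (class_sum tau)) g).
by congr restr; apply/funext => x; apply: eq_bigr => tau _; rewrite /class_form add0r.
Qed.

(** Vertices in one cell differ by a permutation of equal factors as far as distances are
    concerned; equal factors lie in one boundary class, so the permutation leaves the
    class sums unchanged. *)
Lemma expand_same_cell (f : ('I_t -> R) -> R) x y : same_cell m r x y ->
  expand (fun tau => f (class_sum tau)) x = expand (fun tau => f (class_sum tau)) y.
Proof.
move=> /forallP xy.
pose p i : {perm 'I_(m i)} := sval (cid (same_cell_permP _ _ _ _ (xy i))).
have pP i j : gdist (r i) (y (Tagged (fun i => 'I_(m i)) (p i j))) =
    gdist (r i) (x (Tagged (fun i => 'I_(m i)) j)).
  by rewrite /p; case: cid.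
pose pi k : copy := Tagged (fun i => 'I_(m i)) (p (tag k) (tagged k)).
have piI : injective pi.
  move=> [i j] [i' j'] e; have /= ei := congr1 tag e; subst i'.
  by have /= /perm_inj -> := inj_tagged e.
have pi_bij : bijective pi by apply: injF_bij.
have cl_pi k : cl (pi k) = cl k by apply/clP.
pose sh tau : J := [ffun k => tau (pi k)].
have shI : injective sh.
  move=> t1 t2 e; apply/ffunP => k; have [pi' _ pi'K] := pi_bij.
  by have := congr1 (fun u : J => u (pi' k)) e; rewrite !ffunE pi'K.
have csum_sh tau : class_sum (sh tau) = class_sum tau.
  apply/funext => g; rewrite /class_sum [RHS](reindex pi) /=; last exact: onW_bij.
  by apply: eq_big => k; rewrite ?cl_pi // ffunE.
have tvec_sh tau : tensor_vec tau y = tensor_vec (sh tau) x.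
  rewrite /tensor_vec [LHS](reindex pi) /=; last exact: onW_bij.
  apply: eq_bigr => -[i j] _; rewrite ffunE; apply: root_vec_distance; first exact: F_dr.
  exact: pP.
rewrite /expand [LHS](reindex sh) /=; last exact/onW_bij/injF_bij.
by apply: eq_bigr => tau _; rewrite csum_sh tvec_sh.
Qed.

Lemma class_form_class_sum al be : exists f : ('I_t -> R) -> R,
  class_form al be = fun tau => f (class_sum tau).
Proof.
exists (fun y : 'I_t -> R => al (\sum_g y g) + \sum_g be g (\sum_g y g) * y g).
by apply/funext => tau; rewrite /class_form -eig_sumE.
Qed.

Lemma P_sub_Q : (P <= Q_space R m r)%VS.
Proof.
apply/subvP => v /mem_P_space[al [be ->]].
apply/mem_Q_space => [i|i j ij]; first exact: F_conn.
have [f ->] := class_form_class_sum al be; rewrite !mxE; exact: expand_same_cell.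
Qed.

(** * The dimension of P *)

Local Notation fspace := {ffun G -> R^o}.

Definition class_row tau : 'rV[R]_t := \row_g class_sum tau g.
Definition expand_fun c : fspace := [ffun x => expand c x].

Lemma expand_fun_lin b c1 c2 :
  expand_fun (fun tau => b * c1 tau + c2 tau) = b *: expand_fun c1 + expand_fun c2.
Proof. by apply/ffunP => x; rewrite !ffunE expand_lin. Qed.

(** A choice of eigenvalues of weight 0 has a zero factor in its [tensor_vec]. *)
Lemma eq_expand_fun c1 c2 :
  (forall tau, joint_weight tau != 0 -> c1 tau = c2 tau) ->
  expand_fun c1 = expand_fun c2.
Proof.
move=> h; apply/ffunP => x; rewrite !ffunE; apply: eq_bigr => tau _.
have [/eqP|/h -> //] := eqVneq (joint_weight tau) 0.
rewrite /joint_weight prodf_seq_eq0 => /hasP[k _ /eqP wk].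
by rewrite /tensor_vec (bigD1 k) //= root_vec_eq0 // mul0r !mulr0.
Qed.

Lemma expand_fun_sum (I : Type) (L : seq I) (b : I -> R) (c : I -> J -> R) :
  expand_fun (fun tau => \sum_(i <- L) b i * c i tau) = \sum_(i <- L) b i *: expand_fun (c i).
Proof.
elim: L => [|i L IH].
  rewrite big_nil; apply/ffunP => x; rewrite !ffunE /expand big1 // => tau _.
  by rewrite big_nil mul0r.
rewrite big_cons -IH -expand_fun_lin; congr expand_fun; apply/funext => tau.
by rewrite big_cons.
Qed.

Lemma joint_weight_ge0 tau : 0 <= joint_weight tau.
Proof. by apply: prodr_ge0 => k _; apply: copy_weight_ge0. Qed.

(** By [expand_eq0_joint] each term of a vanishing combination vanishes, and the value of each
    component at the root is a sum of nonnegative weights, not all 0. *)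
Lemma free_components (Y : seq 'rV[R]_t) : uniq Y ->
  (forall y : 'rV[R]_t, y \in Y ->
     exists2 tau, joint_weight tau != 0 & class_row tau = y) ->
  free [tuple expand_fun (fun tau => (class_row tau == Y`_k)%:R) | k < size Y].
Proof.
move=> Yu YP; apply/freeP => c; under eq_bigr do rewrite -tnth_nth tnth_mktuple.
move=> c0 i.
pose c' tau := \sum_k c k * (class_row tau == Y`_k)%:R.
have c'0 (x : T) : expand c' x = 0.
  transitivity (expand_fun c' x); first by rewrite ffunE.
  by rewrite expand_fun_sum c0 ffunE.
have := expand_eq0_joint (fun y : 'I_t -> R => ((\row_g y g) == Y`_i)%:R) c'0 a.
have E tau : ((\row_g class_sum tau g) == Y`_i)%:R * c' tau = c i * (class_row tau == Y`_i)%:R.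
  rewrite -/(class_row tau) /c'; case: eqP => [e|_]; last by rewrite mul0r mulr0.
  rewrite mul1r e (bigD1 i) //= eqxx big1 ?addr0 // => k ki.
  by rewrite nth_uniq // eq_sym (negPf (_ : k != i :> nat)) ?mulr0.
rewrite expand_root; under eq_bigr do rewrite E mulrCA.
rewrite -mulr_sumr => /eqP; rewrite mulf_eq0 => /orP[/eqP //|].
have [tau wtau ytau] := YP _ (mem_nth 0 (ltn_ord i)).
rewrite psumr_eq0 => [/allP/(_ tau (mem_index_enum _))|tau' _]; last first.
  by rewrite mulr_ge0 ?joint_weight_ge0 ?ler0n.
by rewrite /= ytau eqxx mulr1 (negPf wtau).
Qed.

(** Coefficients of the function that corresponds to column [j] of the matrix of the rows
    (1, y_1, ..., y_t) over the fiber of [lam]. *)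
Definition column_coef (lam : R) (j : 'I_(1 + t)) tau : R :=
  (eig_sum tau == lam)%:R * row_mx (const_mx 1) (class_row tau) 0 j.

Definition lam_space lam : {vspace fspace} :=
  <<[seq expand_fun (column_coef lam j) | j : 'I_(1 + t)]>>%VS.

Lemma class_row_sum tau : \sum_g class_row tau 0 g = eig_sum tau.
Proof. by rewrite eig_sumE; apply: eq_bigr => g _; rewrite mxE. Qed.

(** The spanning functions are combinations of the free components of the fiber with the
    columns of the matrix as weights, so [dim_span_comb] applies. *)
Lemma dim_lam_space lam (Y : seq 'rV[R]_t) : uniq Y ->
  (forall y : 'rV[R]_t, y \in Y <->
     exists tau, [/\ joint_weight tau != 0, class_row tau = y & eig_sum tau = lam]) ->
  \dim (lam_space lam) =
  \rank (\matrix_(k < size Y) row_mx (const_mx 1) Y`_k : 'M[R]_(size Y, 1 + t)).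
Proof.
move=> Yu YP; set M := (X in \rank X).
rewrite -(dim_span_comb M (free_components Yu _)); last first.
  by move=> y /YP[tau [wt0 yy _]]; exists tau.
congr (\dim <<_>>); apply: eq_map => j.
under [RHS]eq_bigr do rewrite -tnth_nth tnth_mktuple.
rewrite -(expand_fun_sum _ (fun k : 'I_(size Y) => M k j)
  (fun (k : 'I_(size Y)) tau => (class_row tau == Y`_k)%:R)).
apply: eq_expand_fun => tau wt0; rewrite /column_coef.
have [lamE|nlam] := eqVneq (eig_sum tau) lam; last first.
  rewrite mul0r big1 // => k _; case: eqP => [e|]; last by rewrite mulr0.
  have [tau' [_ yt' lt']] := (YP _).1 (mem_nth 0 (ltn_ord k)).
  by case/eqP: nlam; rewrite -lt' -!class_row_sum yt' e.
have yY : class_row tau \in Y by apply/YP; exists tau.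
have ltY : (index (class_row tau) Y < size Y)%N by rewrite index_mem.
rewrite (bigD1 (Ordinal ltY)) //= nth_index // eqxx mulr1 mul1r big1 ?addr0.
  by rewrite /M [RHS]mxE /= nth_index.
move=> k rep'; case: eqP => [e|]; last by rewrite mulr0.
by case/eqP: rep'; apply: val_inj; rewrite /= e index_uniq.
Qed.

Lemma lam_space_support lam u : u \in lam_space lam ->
  exists2 c, u = expand_fun c & forall tau, eig_sum tau != lam -> c tau = 0.
Proof.
pose W := span_set (fun u => exists2 c, u = expand_fun c & forall tau, eig_sum tau != lam -> c tau = 0).
have WP v : v \in W <-> exists2 c, v = expand_fun c & forall tau, eig_sum tau != lam -> c tau = 0.
  apply: mem_span_set => [|b _ _ [c1 -> h1] [c2 -> h2]].
    by exists (fun=> 0) => //; apply/ffunP => x; rewrite !ffunE /expand big1 // => tau _; rewrite mul0r.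
  exists (fun tau => b * c1 tau + c2 tau); first by rewrite expand_fun_lin.
  by move=> tau h; rewrite h1 // h2 // mulr0 addr0.
move=> uL; apply/WP; move: u uL; apply/subvP/span_subvP => _ /mapP[j _ ->].
apply/WP; exists (column_coef lam j) => // tau /negPf h.
by rewrite /column_coef h mul0r.
Qed.

Variable Ls : seq R.
Hypothesis Ls_uniq : uniq Ls.
Hypothesis LsP : forall lam,
  lam \in Ls <-> exists2 tau, joint_weight tau != 0 & eig_sum tau = lam.

Definition total_space : {vspace fspace} := (\sum_(i < size Ls) lam_space Ls`_i)%VS.

(** The summands lie in eigenspaces of the adjacency operator for distinct eigenvalues. *)
Lemma dim_total_space : \dim total_space = (\sum_(i < size Ls) \dim (lam_space Ls`_i))%N.
Proof.
apply/directvP/directv_sum_independent => us usW us0 i _.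
have H (k : 'I_(size Ls)) : exists c, us k = expand_fun c /\ forall tau, eig_sum tau != Ls`_k -> c tau = 0.
  by have [c e h] := lam_space_support (usW k isT); exists c.
have [c Hc] := choice H.
pose c' tau := \sum_(k < size Ls) 1 * c k tau.
have c'0 (x : T) : expand c' x = 0.
  transitivity (expand_fun c' x); first by rewrite ffunE.
  rewrite expand_fun_sum (eq_bigr us) ?us0 ?ffunE // => k _.
  by rewrite scale1r (Hc k).1.
rewrite (Hc i).1; apply/ffunP => x; rewrite !ffunE.
rewrite -[RHS](expand_eq0_joint (fun y : 'I_t -> R => (\sum_g y g == Ls`_i)%:R) c'0 x).
apply: eq_bigr => tau _; congr (_ * _); rewrite -eig_sumE.
case: eqP => [e|/eqP ne]; last by rewrite mul0r (Hc i).2.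
rewrite mul1r /c' (bigD1 i) //= mul1r big1 ?addr0 // => k ki.
by rewrite mul1r (Hc k).2 // e nth_uniq // eq_sym.
Qed.

Lemma total_space_form al be : expand_fun (class_form al be) \in total_space.
Proof.
have -> : expand_fun (class_form al be) = \sum_(k < size Ls)
    (al Ls`_k *: expand_fun (column_coef Ls`_k (lshift t 0)) +
     \sum_g be g Ls`_k *: expand_fun (column_coef Ls`_k (rshift 1 g))).
  pose cc (k : 'I_(size Ls)) tau := al Ls`_k * column_coef Ls`_k (lshift t 0) tau +
     \sum_g be g Ls`_k * column_coef Ls`_k (rshift 1 g) tau.
  rewrite (eq_bigr (fun k : 'I_(size Ls) => 1 *: expand_fun (cc k))) => [|k _]; last first.
    by rewrite scale1r expand_fun_lin expand_fun_sum.
  rewrite -expand_fun_sum; apply: eq_expand_fun => tau wt0.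
  have lL : eig_sum tau \in Ls by apply/LsP; exists tau.
  have ltL : (index (eig_sum tau) Ls < size Ls)%N by rewrite index_mem.
  rewrite (bigD1 (Ordinal ltL)) //= [X in _ = _ + X]big1 ?addr0 => [|k rep'].
    rewrite mul1r /cc /= nth_index // /class_form /column_coef eqxx row_mxEl !mxE !mul1r mulr1.
    congr (_ + _); apply: eq_bigr => g _.
    by rewrite row_mxEr mxE mul1r.
  rewrite mul1r /cc /column_coef (_ : (eig_sum tau == Ls`_k) = false).
    by rewrite mul0r mulr0 add0r big1 // => g _; rewrite mul0r mulr0.
  apply/eqP => e; case/eqP: rep'; apply: val_inj.
  by rewrite /= e index_uniq.
have mem_j (k : 'I_(size Ls)) j : expand_fun (column_coef Ls`_k j) \in lam_space Ls`_k.
  by apply/memv_span/map_f; rewrite mem_enum.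
apply: memv_suml => k _; rewrite (subvP (sumv_sup k _ (subvv _))) //.
rewrite memvD ?memvZ //; apply: memv_suml => g _; exact/memvZ/mem_j.
Qed.

(** Restriction to the deleted graph maps the total space onto P, and its kernel there is the
    line of the indicator of the root. *)
Lemma dim_P_space :
  (\dim P + 1 = \sum_(i < size Ls) \dim (lam_space Ls`_i))%N.
Proof.
pose rho (f : fspace) : 'cV[R]_#|vdel (prod_root m r)| := restr (prod_root m r) f.
have rho_lin : linear rho.
  by move=> b f g; rewrite /rho -restr_lin; apply: eq_restr => x _; rewrite !ffunE.
pose rhoL := GRing.isLinear.Build R _ _ *:%R rho rho_lin.
pose rhoM : {linear fspace -> 'cV[R]_#|vdel (prod_root m r)|} := HB.pack rho rhoL.
have rhoE c : rho (expand_fun c) = rexp c by apply: eq_restr => x _; rewrite ffunE.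
have PE : (linfun rhoM @: total_space)%VS = P.
  apply/vspaceP => v; apply/idP/idP.
    move: v; apply/subvP; rewrite limg_sum; apply/subv_sumP => k _.
    rewrite limg_span; apply/span_subvP => _ /mapP[_ /mapP[j _ ->] ->].
    rewrite (lfunE rhoM) /= rhoE; apply/mem_P_space.
    case: (split_ordP j) => [j0 ->|g ->].
      exists (fun q : R => (q == Ls`_k)%:R), (fun _ _ => 0).
      congr restr; apply/funext => x; apply: eq_bigr => tau _.
      rewrite /column_coef /class_form row_mxEl mxE mulr1 big1 ?addr0 // => g _.
      by rewrite mul0r.
    exists (fun _ : R => 0), (fun h (q : R) => (h == g)%:R * (q == Ls`_k)%:R).
    congr restr; apply/funext => x; apply: eq_bigr => tau _.
    rewrite /column_coef /class_form row_mxEr mxE add0r (bigD1 g) //= eqxx mul1r.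
    by rewrite big1 ?addr0 // => h /negPf ->; rewrite !mul0r.
  move/mem_P_space => [al [be ->]]; rewrite -rhoE -[rho _](lfunE rhoM).
  exact/memv_img/total_space_form.
pose e0 := expand_fun (fun=> 1).
have e0E (x : T) : e0 x = (x == a)%:R by rewrite ffunE expand1.
have kerE : (total_space :&: lker (linfun rhoM))%VS = <[e0]>%VS.
  apply/vspaceP => f; rewrite memv_cap memv_ker (lfunE rhoM); apply/andP/vlineP.
    move=> [_ /eqP f0]; exists (f (a : G)); apply/ffunP => x; rewrite ffunE [e0 x]e0E.
    have [->|xa] := eqVneq x (a : G); first by rewrite /GRing.scale /= mulr1.
    have := @restr_inj R G (prod_root m r) f (fun=> 0) _ x xa.
    rewrite /GRing.scale /= mulr0; apply.
    by rewrite -/(rho f) (f0 : rho f = 0); apply/matrixP => i j; rewrite !mxE.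
  move=> [b ->]; split.
    apply: memvZ; rewrite (_ : e0 = expand_fun (class_form (fun=> 1) (fun _ _ => 0))).
      exact: total_space_form.
    congr expand_fun; apply/funext => tau; rewrite /class_form big1 ?addr0 // => g _.
    by rewrite mul0r.
  by rewrite linearZ /= rhoE rexp1 scaler0.
rewrite -dim_total_space -(limg_ker_dim (linfun rhoM) total_space) PE kerE addnC dim_vline.
rewrite (_ : e0 != 0) //; apply/eqP => /ffunP/(_ (a : G)); rewrite [e0 _]e0E eqxx ffunE.
by move/eqP; rewrite oner_eq0.
Qed.

End ProductSpectrum.

(** * Boundary classes and the rank formula *)

Section BoundaryClasses.
Variables (R : realType) (s : nat) (F : 'I_s -> sgraph) (m : 'I_s -> nat).
Variables (r : forall i, F i).
Local Notation copy := (copy m).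
Local Notation classes := (boundary_classes R m r).

Definition same_boundary (k l : copy) : bool :=
  `[< Defs.eta R (r (tag k)) = Defs.eta R (r (tag l)) >].

Lemma same_boundary_equiv :
  {in [set: copy]%SET & &, equivalence_rel same_boundary}.
Proof.
move=> x y z _ _ _; split; first exact/asboolP.
by move/asboolP => e; rewrite /same_boundary e.
Qed.

Lemma boundary_partition : finset.partition classes [set: copy]%SET.
Proof. exact: equivalence_partitionP same_boundary_equiv. Qed.

Lemma pblock_class k : finset.pblock classes k \in classes.
Proof.
by have /and3P[/eqP c _ _] := boundary_partition; rewrite pblock_mem // c inE.
Qed.

Definition class_of (k : copy) : 'I_#|classes| :=
  enum_rank_in (pblock_class k) (finset.pblock classes k).

Lemma class_ofK k : enum_val (class_of k) = finset.pblock classes k.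
Proof. by rewrite enum_rankK_in // pblock_class. Qed.

Lemma mem_class k (g : 'I_#|classes|) : (k \in enum_val g) = (class_of k == g).
Proof.
have /and3P[/eqP c tI _] := boundary_partition.
apply/idP/eqP => [kg|<-]; last by rewrite class_ofK mem_pblock c inE.
by apply: enum_val_inj; rewrite class_ofK; apply: finset.def_pblock tI (enum_valP g) kg.
Qed.

Lemma class_of_eq k l :
  class_of k = class_of l <-> Defs.eta R (r (tag k)) = Defs.eta R (r (tag l)).
Proof.
have h : (l \in finset.pblock classes k) = same_boundary k l.
  by rewrite (pblock_equivalence_partition same_boundary_equiv) ?inE.
rewrite -class_ofK mem_class in h; split=> [e|/asboolP e].
  by apply/asboolP; have : same_boundary k l by rewrite -h e.
by apply/esym/eqP; rewrite h.
Qed.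

Lemma class_of_surj (g : 'I_#|classes|) : exists k, class_of k = g.
Proof.
have /and3P[_ _ n0] := boundary_partition.
have /set0Pn[k kg] : enum_val g != finset.set0.
  by apply: contra n0 => /eqP <-; apply: enum_valP.
by exists k; apply/eqP; rewrite -mem_class.
Qed.

Variables (n : nat) (th : 'I_n -> R).
Hypothesis th_cover : forall i t, @omega R (F i) (r i) t != 0 -> exists j, th j = t.

Local Notation joint_weight := (joint_weight (copy_weight r th)).
Local Notation class_row := (class_row th class_of).
Local Notation eig_sum := (eig_sum th).

(** A point of the product of the sumsets is a choice of one eigenvalue per copy, made
    class by class. *)
Lemma T_prodP y : @T_prod R s F m r y <->
  exists tau : {ffun copy -> 'I_n}, joint_weight tau != 0 /\ class_row tau = y.
Proof.
split=> [Ty|[tau [wt0 <-]] g]; last first.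
  exists (fun k => th (tau k)) => [k _|].
    rewrite /Theta -omega_eq0.
    by move: wt0 => /prodf_neq0/(_ k isT).
  by rewrite mxE; apply: eq_bigl => k; rewrite mem_class.
pose TH g := s2val (cid2 (Ty g)).
have TH1 (g : 'I_#|classes|) (k : copy) : k \in enum_val g -> Theta R (r (tag k)) (TH g k).
  by rewrite /TH; case: cid2 => /= f h _; apply: h.
have TH2 (g : 'I_#|classes|) : y 0 g = \sum_(k in enum_val g) TH g k by rewrite /TH; case: cid2.
have H (k : copy) : exists j, th j = TH (class_of k) k.
  by apply: (@th_cover (tag k)); rewrite omega_eq0; apply: TH1; rewrite mem_class.
have [f Hf] := choice H; exists [ffun k => f k]; split.
  apply/prodf_neq0 => k _; rewrite /copy_weight ffunE Hf omega_eq0.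
  by apply: TH1; rewrite mem_class.
apply/rowP => g; rewrite mxE TH2; apply: eq_big => k; first by rewrite mem_class.
by move/eqP => <-; rewrite ffunE Hf.
Qed.

Lemma finite_T_fiber lam : finite_set (@T_fiber R s F m r lam).
Proof.
apply: (@sub_finite_set _ _ [set class_row tau | tau in [set: {ffun copy -> 'I_n}]]%classic).
  by move=> y [/T_prodP[tau [_ <-]] _]; exists tau.
exact: finite_image.
Qed.

Lemma LambdaP lam : Lambda R m r lam <->
  exists2 tau : {ffun copy -> 'I_n}, joint_weight tau != 0 & eig_sum tau = lam.
Proof.
split=> [[y /T_prodP[tau [wt0 <-]] ->]|[tau wt0 <-]].
  by exists tau; rewrite ?class_row_sum.
by exists (class_row tau); [apply/T_prodP; exists tau | rewrite class_row_sum].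
Qed.

End BoundaryClasses.

Lemma dim_P_space_rank (R : realType) (s : nat) (F : 'I_s -> sgraph)
    (m : 'I_s -> nat) (r : forall i, F i) :
  (forall i, nontrivial (F i)) -> (forall i, distance_regular (F i)) ->
  (P_space R (prod_root m r) <= Q_space R m r)%VS /\
  (\dim (P_space R (prod_root m r)))%:Z =
    (\sum_(lam \in Lambda R m r) (\rank (R_mx m r lam))%:Z) - 1.
Proof.
move=> Fn Fd; have [n [th [th_inj Hth]]] := theta_family R r.
have th_cover i t : @omega R (F i) (r i) t != 0 -> exists j, th j = t.
  by have [h _] := Hth i; apply: h.
have th_sum i x : \sum_j root_vec (r i) (th j) x = (x == r i)%:R by have [_ ->] := Hth i.
have clP (k l : copy m) : class_of R r k = class_of R r l <->
    boundary_fun th (copy_weight r th) (@copy_valency R _ _ m r) k =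
    boundary_fun th (copy_weight r th) (@copy_valency R _ _ m r) l.
  by rewrite class_of_eq !(eta_boundary_fun th_inj th_cover).
have PQ := P_sub_Q Fn Fd th_sum clP (@class_of_surj R s F m r).
split; first exact: PQ.
pose Ls := undup [seq eig_sum th tau | tau <- enum {: {ffun copy m -> 'I_n}} &
    joint_weight (copy_weight r th) tau != 0].
have LsP lam : lam \in Ls <->
    exists2 tau : {ffun copy m -> 'I_n}, joint_weight (copy_weight r th) tau != 0 & eig_sum th tau = lam.
  rewrite mem_undup; split=> [/mapP[tau]|[tau wt0 <-]].
    by rewrite mem_filter => /andP[wt0 _] ->; exists tau.
  by apply: map_f; rewrite mem_filter wt0 mem_enum.
have Lsu : uniq Ls by apply: undup_uniq.
have := dim_P_space Fn Fd th_sum clP (@class_of_surj R s F m r) Lsu LsP.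
rewrite (fsbigE Ls) //=; last 2 first.
- by move=> lam /= /LsP h; exact: (proj2 (@LambdaP R s F m r n th th_cover lam) h).
- by move=> lam /(proj1 (@LambdaP R s F m r n th th_cover lam))/LsP ->.
move=> dimE; rewrite (big_nth 0) big_mkord.
rewrite -[LHS](addrK 1) -[1 in X in X - _]/(1%N%:Z) -PoszD dimE; congr (_ - 1).
rewrite (big_morph Posz PoszD (erefl _)); apply: eq_big => [i|i _].
  apply/esym/mem_set; have /LsP h := mem_nth 0 (ltn_ord i).
  exact: (proj2 (@LambdaP R s F m r n th th_cover _) h).
congr Posz.
apply: (dim_lam_space (cl := class_of R r) (Y := fset_set (@T_fiber R s F m r Ls`_i))) => [|y].
  exact: fset_uniq.
rewrite in_fset_set; last exact: finite_T_fiber th_cover _.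
split=> [/set_mem[/(T_prodP th_cover)[tau [wt0 <-]] e]|[tau [wt0 <- e]]].
  by exists tau; split=> //; rewrite -e class_row_sum.
apply/mem_set; split; first by apply/(T_prodP th_cover); exists tau.
by rewrite class_row_sum.
Qed.

Theorem proposition7p2 (R : realType) (s : nat) (F : 'I_s -> sgraph)
    (m : 'I_s -> nat) (r : forall i : 'I_s, F i)
    (s_gt0 : (0 < s)%N)
    (F_noniso : forall i j : 'I_s, i != j -> ~ graph_iso (F i) (F j))
    (F_connected : forall i : 'I_s, graph_connected (F i))
    (F_nontrivial : forall i : 'I_s, nontrivial (F i))
    (F_transitive : forall i : 'I_s, vertex_transitive (F i))
    (F_prime : forall i : 'I_s, cartesian_prime (F i))
    (F_dr : forall i : 'I_s, distance_regular (F i))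
    (m_gt0 : forall i : 'I_s, (0 < m i)%N) :
  let a := prod_root m r in
  let P := P_space R a in
  let Q := Q_space R m r in
  let U := U_space R a in
  [/\ (P <= Q)%VS /\ (Q <= U)%VS,
      (\dim Q + 1 = \prod_(i < s) 'C(diameter (F i) + m i, m i))%N,
      [/\ delta_ominus R a = delta_met R m r + delta_orb R m r,
          0 <= delta_met R m r & 0 <= delta_orb R m r],
      (\dim P)%:Z =
        (\sum_(lam \in Lambda R m r) (\rank (R_mx m r lam))%:Z) - 1 &
      (\dim U)%:Z =
        (\prod_(i < s) 'C(num_orbits (r i) + m i - 1, m i))%N%:Z - 1].
Proof.
move=> a P Q U.
have [PQ dimP] : (P <= Q)%VS /\ (\dim P)%:Z =
    (\sum_(lam \in Lambda R m r) (\rank (R_mx m r lam))%:Z) - 1.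
  exact: dim_P_space_rank.
have QU : (Q <= U)%VS by apply: Q_sub_U.
split=> //.
- exact: dim_Q_space.
- split; first by rewrite /delta_ominus /delta_met /delta_orb [RHS]addrC subrKA.
    by rewrite subr_ge0 lez_nat dimvS.
  by rewrite subr_ge0 lez_nat dimvS.
rewrite -(dim_U_space R m r F_noniso F_connected F_prime).
by rewrite PoszD addrK.
Qed.
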